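(* Let $\pi:X\to\mathbb{P}^{4}$ be a cyclic triple cover branched over a hypersurface $S\subset\mathbb{P}^{4}$ of degree $6$ such that $S$ is defined over a number field, $S$ has an ordinary triple point, and $S$ is sufficiently general (that is, it belongs to the complement of a proper Zariski closed subset in the moduli of such hypersurfaces). Then rational points are potentially dense on $X$.
   Context: A cyclic triple cover is a finite morphism of degree $3$ that induces a cyclic extension of the fields of rational functions. If $S$ is given by $f_6(x_0,\ldots,x_4)=0$ with $f_6$ homogeneous of degree $6$ with coefficients in a number field $\mathbb{F}$, then $X$ is the hypersurface $y^3=f_6(x_0,\ldots,x_4)$ in the weighted projective space $\mathbb{P}(1^5,2)=\mathrm{Proj}(\mathbb{F}[x_0,\ldots,x_4,y])$ (with $x_i$ of weight $1$ and $y$ of weight $2$), and $\pi$ is the restriction of the natural projection to $\mathbb{P}^4$. An ordinary triple point of $S$ is a point $O\in S$ of multiplicity $3$ such that the projectivization of the tangent cone to $S$ at $O$ is a smooth cubic surface in $\mathbb{P}^3$. The set of rational points of a variety $V$ defined over a number field $\mathbb{F}$ is called potentially dense if for some finite extension of fields $\mathbb{K}/\mathbb{F}$ the set of $\mathbb{K}$-rational points of $V$ is Zariski dense in $V$. *)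

(* Defs.v *)
From HB Require Import structures.
From mathcomp Require Import all_boot all_order all_algebra all_fingroup all_field.
From mathcomp Require Export mpoly.

Set Implicit Arguments.
Unset Strict Implicit.
Unset Printing Implicit Defensive.

Import GRing.Theory.
Local Open Scope ring_scope.

(* Points of (weighted) projective spaces are given by nonzero vectors of
   homogeneous coordinates; every predicate below is invariant under the
   corresponding rescaling of these vectors. *)

Definition nonzero_vec (K : fieldType) (n : nat) (v : 'I_n -> K) : Prop :=
  exists i, v i != 0.

Definition sextic (K : fieldType) (f : {mpoly K[5]}) : Prop :=
  f != 0 /\ f \is 6.-homog.

(* The equation of the hypersurface f = 0 of P^4 in the affine chart x_i != 0,
   where x_i is set to 1, with the origin translated to the point p. *)
Definition local_equation (K : fieldType) (f : {mpoly K[5]}) (p : 'I_5 -> K)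
    (i : 'I_5) : {mpoly K[4]} :=
  f \mPo [tuple (if unlift i j is Some k then (p j / p i)%:MP + 'X_k else 1)
         | j < 5].

(* The tangent cone of g = 0 at the origin is the zero locus of the form
   pihomog mdeg d g, where d is the multiplicity of the origin. *)
Definition multiplicity_at_origin (K : fieldType) (n : nat)
    (g : {mpoly K[n]}) (d : nat) : Prop :=
  (forall k, (k < d)%N -> pihomog mdeg k g = 0) /\ pihomog mdeg d g != 0.

(* Over algC, smoothness may be tested on closed points by the Jacobian
   criterion. *)
Definition smooth_projective_hypersurface (n : nat) (c : {mpoly algC[n]}) :
    Prop :=
  forall v : 'I_n -> algC, nonzero_vec v -> c.@[v] = 0 ->
    exists i, (c^`M(i)).@[v] != 0.

Definition ordinary_triple_point (f : {mpoly algC[5]}) (p : 'I_5 -> algC) :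
    Prop :=
  exists i : 'I_5, [/\ p i != 0,
    multiplicity_at_origin (local_equation f p i) 3%N &
    smooth_projective_hypersurface (pihomog mdeg 3%N (local_equation f p i))].

Definition triple_point_sextic (f : {mpoly algC[5]}) : Prop :=
  sextic f /\ exists p : 'I_5 -> algC, ordinary_triple_point f p.

Definition sextic_monomials : pred 'X_{1..5 < 7} :=
  [pred m : 'X_{1..5 < 7} | mdeg m == 6%N].

(* Homogeneous coordinates of the hypersurface f = 0 in the projective space
   P^209 of all sextic threefolds. *)
Definition sextic_coords (f : {mpoly algC[5]}) (k : 'I_#|sextic_monomials|) :
    algC :=
  f@_(bmnm (enum_val k)).

Definition linear_substitution (A : 'M[algC]_5) (f : {mpoly algC[5]}) :
    {mpoly algC[5]} :=
  f \mPo [tuple \sum_(j < 5) A i j *: 'X_j | i < 5].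

(* The moduli of sextics with an ordinary triple point is the quotient, by
   projective equivalence, of the corresponding subset of P^209.  A closed
   subset of it is given by its inverse image Z: a closed, projectively
   invariant subset of the set of these sextics. *)
Definition closed_in_moduli (Z : {mpoly algC[5]} -> Prop) : Prop :=
  (exists E : {mpoly algC[#|sextic_monomials|]} -> Prop,
     (forall P, E P -> exists d, P \is d.-homog) /\
     (forall f, triple_point_sextic f ->
        (Z f <-> forall P, E P -> P.@[sextic_coords f] = 0))) /\
  (forall f (A : 'M[algC]_5), triple_point_sextic f -> A \in unitmx ->
     (Z (linear_substitution A f) <-> Z f)).

Definition proper_closed_in_moduli (Z : {mpoly algC[5]} -> Prop) : Prop :=
  closed_in_moduli Z /\ exists f, triple_point_sextic f /\ ~ Z f.

(* Coordinates of P(1^5, 2): the variables x_0, ..., x_4 are the first five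
   ones, and y is the last one. *)
Definition weight (i : 'I_6) : nat := if i == ord_max then 2%N else 1%N.

Definition wdeg (m : 'X_{1..6}) : nat := (\sum_(i < 6) weight i * m i)%N.

Lemma wdeg0 : wdeg 0%MM = 0%N.
Proof. by rewrite /wdeg big1 // => i _; rewrite mnm0E muln0. Qed.

Lemma wdegD : {morph wdeg : m1 m2 / (m1 + m2)%MM >-> (m1 + m2)%N}.
Proof.
by move=> m1 m2; rewrite /wdeg -big_split; apply: eq_bigr => i _;
  rewrite mnmDE mulnDr.
Qed.

HB.instance Definition _ := isMeasure.Build 6 wdeg wdeg0 wdegD.

Definition triple_cover (K : fieldType) (f : {mpoly K[5]}) : {mpoly K[6]} :=
  'X_ord_max ^+ 3 - mwiden f.

(* v represents a K-point of the triple cover y^3 = f in P(1^5, 2).  On the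
   cover the x_i do not all vanish, so that a K-rational point has coordinates
   in K: normalise some x_i to 1. *)
Definition on_triple_cover (K : fieldType) (f : {mpoly K[5]})
    (v : 'I_6 -> K) : Prop :=
  nonzero_vec v /\ (triple_cover f).@[v] = 0.

Definition zariski_dense_in (A X : ('I_6 -> algC) -> Prop) : Prop :=
  forall (d : nat) (g : {mpoly algC[6]}), g \is d.-homog for wdeg ->
    (forall v, A v -> g.@[v] = 0) -> forall v, X v -> g.@[v] = 0.

(* iota and j realise the tower F <= K inside the algebraic closure algC. *)
Definition potentially_dense (F : fieldExtType rat)
    (iota : {rmorphism F -> algC}) (f : {mpoly F[5]}) : Prop :=
  exists (K : fieldExtType F) (j : {rmorphism K -> algC}),
    (forall a : F, j a%:A = iota a) /\
    zariski_dense_in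
      (fun w => exists v : 'I_6 -> K,
         on_triple_cover (map_mpoly (in_alg K) f) v /\ (forall i, w i = j (v i)))
      (on_triple_cover (map_mpoly iota f)).

(* Main.v *)
Require Import Defs.
From mathcomp Require Import all_boot all_order all_algebra all_field.
From mathcomp Require Import ring zify.
From Stdlib Require Import Classical FunctionalExtensionality.

(** Let [p] be the triple point.  On the line through [p] with direction [z] the
    equation of the sextic reads [c3(z) r^3 + c4(z) r^2 + c5(z) r + c6(z)], so
      the
    triple cover [y^3 = f] is fibred over the projective space of the [z] by the
    plane cubics [y^3 = c3 r^3 + c4 r^2 + c5 r + c6].  Each has three points at
    infinity, and these are rational over [K] exactly when [c3(z)] is a cube in
    [K], which contains the cube roots of unity.

    Rational points on the fibres.  Put [T = c3 r] and [Y = w^2 y] with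
    [w^3 = c3(z)]: the fibre becomes [Y^3 = T^3 + A T^2 + B T + C] with [A =
      c4],
    [B = c3 c5] and [C = c3^2 c6].  Starting at a point at infinity and drawing
    tangents over and over gives points whose coordinates are polynomial in [A],
    [B], [C] ([tangent_orbit_on_cubic]).  They are pairwise distinct on the
      generic
    fibre if [c4] does not vanish identically on the surface [c3 = 0]: there
    [B = C = 0], the cubic has a cusp, its smooth points form an additive group
      of
    characteristic zero, and drawing the tangent multiplies by [-2]
    ([tangent_orbit_cusp], [generic_orbit_points]).

    Density of the good fibres.  The points [z] of [K^4] where [c3(z)] is a cube
    of [K] are the [K]-points of the smooth cubic threefold [w^3 = c3(z)].  It
    contains a line, spanned by [(q, 0)] and [(v, w0)], where [q] is a point of
      the
    surface and the line [q v] is an inflectional tangent there; the tangent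
    directions along a line of a cubic threefold parametrise the threefold
    ([line_map_cube], [line_map_onto]).  Hence over a number field that contains
    these data such [z] are dense ([cube_values_dense]).  A polynomial that
      vanishes
    at all rational points of the cover then vanishes on the generic fibre, and
      so
    on the cover ([rational_points_dense_on_cover]).

    The generality assumption.  If [c4] vanishes on the smooth cubic surface
    [c3 = 0], it is a multiple [l c3] with [l] a linear form
    ([quartic_linear_multiple]), and completing the cube puts the sextic in the
      form
    [M^3 C + M Q5 + Q6], with [C], [Q5] and [Q6] forms in four linear forms that
    vanish at [p] ([quartic_free]).  The closed set of the theorem is the
      Zariski
    closure of these sextics.  It is invariant under linear substitutions.  It
      is
    proper by counting: a quartic-free sextic depends on 170 parameters, but 175
    coefficients of a sextic with a given ordinary triple point and given
      tangent
    cone can be chosen freely ([algebraic_dependence],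
    [quartic_free_closure_proper]). *)

Set Implicit Arguments.
Unset Strict Implicit.
Unset Printing Implicit Defensive.

Import GRing.Theory Num.Theory.
Local Open Scope ring_scope.

Lemma base_expansion_inj (B n : nat) (a b : 'I_n -> nat) :
  (forall i, a i < B)%N -> (forall i, b i < B)%N ->
  (\sum_(i < n) a i * B ^ i = \sum_(i < n) b i * B ^ i)%N -> a =1 b.
Proof.
elim: n a b => [|n IHn] a b aB bB; first by move=> _ [].
have shift (c : 'I_n.+1 -> nat) : (\sum_(i < n.+1) c i * B ^ i =
    (\sum_(i < n) c (lift ord0 i) * B ^ i) * B + c ord0)%N.
  rewrite big_ord_recl /= muln1 addnC big_distrl /=; congr (_ + _)%N.
  by apply: eq_bigr => i _; rewrite /bump /= add1n expnSr mulnA.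
rewrite !shift => Eab.
have B0 : (0 < B)%N by apply: leq_ltn_trans (aB ord0).
have E0 : a ord0 = b ord0.
  by have := congr1 (modn^~ B) Eab; rewrite !modnMDl !modn_small.
move: Eab; rewrite E0 => /addIn /eqP; rewrite eqn_pmul2r // => /eqP Eab.
move=> i; have [j ->|->//] := unliftP ord0 i.
exact: (IHn (fun i => a (lift ord0 i)) (fun i => b (lift ord0 i))).
Qed.

Lemma poly_eq0_nat (R : numDomainType) (p : {poly R}) :
  (forall k : nat, p.[k%:R] = 0) -> p = 0.
Proof.
move=> p0; apply/eqP; apply: contraT => pN0.
have := max_poly_roots pN0 (rs := [seq k%:R | k <- iota 0 (size p)]).
rewrite size_map size_iota ltnn; apply.
  by apply/allP => _ /mapP[k _ ->]; rewrite /root p0.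
by rewrite map_inj_uniq ?iota_uniq // => i j /eqP; rewrite eqr_nat => /eqP.
Qed.

(** Kronecker substitution ['X_i := t ^ (B ^ i)] turns a polynomial whose
    exponents are all smaller than [B] into a univariate polynomial with the
    same coefficients, which has only finitely many roots. *)
Lemma mpoly_eq0_nat (R : numDomainType) (n : nat) (P : {mpoly R[n]}) :
  (forall v : 'I_n -> nat, P.@[fun i => (v i)%:R] = 0) -> P = 0.
Proof.
move=> P0; pose B := msize P.
have mB m : m \in msupp P -> forall i, (m i < B)%N.
  move=> /msize_mdeg_lt mlt i; apply: leq_ltn_trans mlt.
  by rewrite mdegE (bigD1 i) //= leq_addr.
pose k (m : 'X_{1..n}) := (\sum_(i < n) m i * B ^ i)%N.
pose q : {poly R} := \sum_(m <- msupp P) P@_m *: 'X^(k m).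
have q0 : q = 0.
  apply: poly_eq0_nat => t; rewrite -[RHS](P0 (fun i : 'I_n => t ^ (B ^ i))%N).
  rewrite mevalE horner_sum; apply: eq_bigr => m _.
  rewrite hornerZ hornerXn; congr (_ * _).
  under [RHS]eq_bigr => i _ do rewrite natrX -exprM.
  by rewrite prodrXr /k; congr (_ ^+ _); apply: eq_bigr => i _; rewrite mulnC.
apply/mpolyP => m; rewrite mcoeff0.
have [mP|/memN_msupp_eq0//] := boolP (m \in msupp P).
have := congr1 (fun r : {poly R} => r`_(k m)) q0.
rewrite coef0 coef_sum (bigD1_seq m) ?msupp_uniq //= coefZ coefXn eqxx mulr1.
rewrite big_seq_cond big1 ?addr0 // => m' /andP[m'P mm'].
rewrite coefZ coefXn; case: eqP => [Ek|]; last by rewrite mulr0.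
case/eqP: mm'; apply/mnmP/(base_expansion_inj (mB _ m'P) (mB _ mP)).
exact/esym.
Qed.

(** * Polynomial functions *)

Definition polyfun (n : nat) (phi : ('I_n -> algC) -> algC) : Prop :=
  exists P : {mpoly algC[n]}, forall v, phi v = P.@[v].

Section PolynomialFunctions.

Variable n : nat.
Implicit Types phi psi : ('I_n -> algC) -> algC.

Lemma polyfunC (c : algC) : polyfun (fun _ : 'I_n -> algC => c).
Proof. by exists c%:MP => v; rewrite mevalC. Qed.

Lemma polyfun_coord (i : 'I_n) : polyfun (fun v => v i).
Proof. by exists 'X_i => v; rewrite mevalXU. Qed.

Lemma polyfunD phi psi :
  polyfun phi -> polyfun psi -> polyfun (fun v => phi v + psi v).
Proof. by move=> [P EP] [Q EQ]; exists (P + Q) => v; rewrite mevalD EP EQ. Qed.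

Lemma polyfunM phi psi :
  polyfun phi -> polyfun psi -> polyfun (fun v => phi v * psi v).
Proof. by move=> [P EP] [Q EQ]; exists (P * Q) => v; rewrite mevalM EP EQ. Qed.

Lemma polyfunN phi : polyfun phi -> polyfun (fun v => - phi v).
Proof. by move=> [P EP]; exists (- P) => v; rewrite mevalN EP. Qed.

Lemma polyfunX phi k : polyfun phi -> polyfun (fun v => phi v ^+ k).
Proof. by move=> [P EP]; exists (P ^+ k) => v; rewrite rmorphXn EP. Qed.

Lemma polyfun_sum (I : Type) (r : seq I) (p : pred I)
    (phi : I -> ('I_n -> algC) -> algC) :
  (forall i, polyfun (phi i)) -> polyfun (fun v => \sum_(i <- r | p i) phi i v).
Proof.
move=> phiP; elim: r => [|i r [P EP]].
  by exists 0 => v; rewrite big_nil meval0.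
have [Q EQ] := phiP i; exists ((if p i then Q else 0) + P) => v.
by rewrite big_cons mevalD -EP; case: (p i); rewrite ?EQ ?meval0 ?add0r.
Qed.

Lemma polyfun_prod (I : Type) (r : seq I) (p : pred I)
    (phi : I -> ('I_n -> algC) -> algC) :
  (forall i, polyfun (phi i)) -> polyfun (fun v => \prod_(i <- r | p i) phi i
    v).
Proof.
move=> phiP; elim: r => [|i r [P EP]].
  by exists 1 => v; rewrite big_nil meval1.
have [Q EQ] := phiP i; exists ((if p i then Q else 1) * P) => v.
by rewrite big_cons mevalM -EP; case: (p i); rewrite ?EQ ?meval1 ?mul1r.
Qed.

Lemma polyfun_meval m (P : {mpoly algC[m]}) (phi : 'I_m -> ('I_n -> algC) ->
  algC) :
  (forall i, polyfun (phi i)) -> polyfun (fun v => P.@[fun i => phi i v]).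
Proof.
move=> phiP; have [Q EQ] : exists Q : 'I_m -> {mpoly algC[n]},
    forall i v, phi i v = (Q i).@[v].
  have [Q EQ] := fin_all_exists phiP; by exists Q.
exists (P \mPo [tuple Q i | i < m]) => v; rewrite comp_mpoly_meval.
by apply: meval_eq => i; rewrite tnth_mktuple.
Qed.

Lemma eq_polyfun phi psi : phi =1 psi -> polyfun phi -> polyfun psi.
Proof. by move=> E [P EP]; exists P => v; rewrite -E. Qed.

(** Natural points are Zariski dense, so polynomial functions inherit the
    cancellation properties of polynomials. *)
Lemma polyfun_eq0_nat phi :
  polyfun phi -> (forall v : 'I_n -> nat, phi (fun i => (v i)%:R) = 0) ->
  forall v, phi v = 0.
Proof.
move=> [P EP] phi0 v; rewrite EP (@mpoly_eq0_nat _ _ P) ?meval0 // => u.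
by rewrite -EP.
Qed.

Lemma polyfun_mul_eq0 phi psi :
  polyfun phi -> polyfun psi -> (forall v, phi v * psi v = 0) ->
  forall u, psi u != 0 -> forall v, phi v = 0.
Proof.
move=> [P EP] [Q EQ] PQ0 u; rewrite EQ => Qu v.
have /eqP : P * Q = 0.
  by apply: mpoly_eq0_nat => w; rewrite mevalM -EP -EQ.
rewrite mulf_eq0 => /orP[] /eqP E; first by rewrite EP E meval0.
by rewrite E meval0 eqxx in Qu.
Qed.

Lemma polyfun_mul_neq0 phi psi :
  polyfun phi -> polyfun psi -> (exists v, phi v != 0) ->
  (exists v, psi v != 0) -> exists v, phi v * psi v != 0.
Proof.
move=> phiP psiP [v phiv] [u psiu]; apply: NNPP => no.
case/eqP: phiv; apply: (polyfun_mul_eq0 phiP psiP) psiu _ => w.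
by apply/eqP; apply: contraT => wN0; case: no; exists w.
Qed.

End PolynomialFunctions.

Lemma meval_exp (R : comNzRingType) n (P : {mpoly R[n]}) k v :
  (P ^+ k).@[v] = P.@[v] ^+ k.
Proof. exact: rmorphXn. Qed.

Lemma meval_inj_alg (n : nat) (P Q : {mpoly algC[n]}) :
  (forall v, P.@[v] = Q.@[v]) -> P = Q.
Proof.
move=> E; apply/eqP; rewrite -subr_eq0; apply/eqP/mpoly_eq0_nat => v.
by rewrite mevalB E subrr.
Qed.

(** * Tangents to the plane cubics [W^3 = U^3 + A U^2 V + B U V^2 + C V^3] *)

Section TangentProcess.

Variables (R : comNzRingType) (A B C : R).

Definition binary_cubic (U V : R) : R :=
  U ^+ 3 + A * U ^+ 2 * V + B * U * V ^+ 2 + C * V ^+ 3.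

Definition on_cubic (P : R * R * R) : Prop :=
  P.2 ^+ 3 = binary_cubic P.1.1 P.1.2.

(** The third intersection of the cubic with its tangent at [(U : V : W)]; the
    powers [W ^ 3] are replaced by the cubic form [g] of [U] and [V]. *)
Definition tangent_step (P : R * R * R) : R * R * R :=
  let: (U, V, W) := P in
  let g := binary_cubic U V in
  let g1 := 3%:R * U ^+ 2 + 2%:R * A * U * V + B * V ^+ 2 in
  let g2 := 6%:R * U + 2%:R * A * V in
  let D := 2%:R * (27%:R * g ^+ 2 - g1 ^+ 3) in
  (U * D + (18%:R * g * g1 ^+ 2 - 27%:R * g ^+ 2 * g2), V * D,
   W * (54%:R * g ^+ 2 + 4%:R * g1 ^+ 3 - 9%:R * g * g1 * g2)).

(** The third intersection of the cubic with its tangent at the point at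
    infinity [(1 : 0 : 1)], where the formulas of [tangent_step] degenerate. *)
Definition tangent_start : R * R * R :=
  (27%:R * C - A ^+ 3, 9%:R * A ^+ 2 - 27%:R * B,
   27%:R * C + 2%:R * A ^+ 3 - 9%:R * A * B).

Definition tangent_orbit (n : nat) : R * R * R :=
  iter n tangent_step tangent_start.

Lemma tangent_step_on_cubic P : on_cubic P -> on_cubic (tangent_step P).
Proof.
case: P => [[U V] W]; rewrite /on_cubic /tangent_step /= exprMn => ->.
set g := binary_cubic U V.
set g1 := 3%:R * _ + _ + _; set g2 := 6%:R * _ + _.
set N := 18%:R * _ * _ - _; set D := 27%:R * _ - _.
(* The Taylor expansion of the cubic at [U] leaves an identity in [g], [g1]
   and [g2] only. *)
have -> : binary_cubic (U * (2%:R * D) + N) (V * (2%:R * D)) =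
    8%:R * D ^+ 3 * g + 4%:R * D ^+ 2 * N * g1 + D * N ^+ 2 * g2 + N ^+ 3.
  by rewrite /binary_cubic /g /g1 /g2 /binary_cubic; ring.
rewrite /N /D {N D}; move: g g1 g2 => g g1 g2; ring.
Qed.

Lemma tangent_orbit_on_cubic n : on_cubic (tangent_orbit n).
Proof.
elim: n => [|n IHn]; last exact: tangent_step_on_cubic.
by rewrite /on_cubic /tangent_orbit /= /binary_cubic; ring.
Qed.

End TangentProcess.

(** When [B = C = 0] the cubic has a cusp, its smooth points form an additive
    group in which tangency is multiplication by [-2], and the point at infinity
    is a non-zero element. *)
Lemma tangent_orbit_cusp (K : numFieldType) (A : K) (n : nat) : A != 0 ->
  let u : K := (-2%:R) ^+ n.+1 in
  exists2 k : K, k != 0 &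
    tangent_orbit A 0 0 n = (k * A, k * (u ^+ 3 - 1), k * (u * A)).
Proof.
move=> A0; elim: n => [|n [k k0 IHn]] /=.
  exists (- A ^+ 2); first by rewrite oppr_eq0 expf_neq0.
  by rewrite /tangent_orbit /tangent_start /=; congr (_, _, _); ring.
have u1 : (-2%:R : K) ^+ n.+1 ^+ 3 - 1 != 0.
  rewrite subr_eq0 -exprM exprNn; apply: contraTneq isT => E.
  have := congr1 (fun x : K => `|x|) E.
  rewrite normrM normrX normrN1 expr1n mul1r normr1 normrX normr_nat -natrX.
  by move=> /eqP; rewrite pnatr_eq1 gtn_eqF // -(expn0 2) ltn_exp2l.
exists (2%:R * k ^+ 7 * A ^+ 6 * ((-2%:R) ^+ n.+1 ^+ 3 - 1) ^+ 3).
  by rewrite !mulf_neq0 ?expf_neq0 ?pnatr_eq0.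
rewrite -/(tangent_orbit A 0 0 n) IHn [_ ^+ n.+2]exprS.
move: (_ ^+ n.+1) => u; rewrite /tangent_step /binary_cubic.
by congr (_, _, _); ring.
Qed.

(** * Polarisation of cubic forms *)

Section CubicForms.

Variable n : nat.
Implicit Types x y z : 'I_n -> algC.

Definition lincomb (a : algC) x (b : algC) y : 'I_n -> algC :=
  fun i => a * x i + b * y i.

Definition unit_vec (k : 'I_n) : 'I_n -> algC := fun i => (i == k)%:R.

Definition trilinear (T : 'I_n -> 'I_n -> 'I_n -> algC) x y z : algC :=
  \sum_(i < n) \sum_(j < n) \sum_(k < n) T i j k * (x i * y j * z k).

Definition symmetric_tensor (T : 'I_n -> 'I_n -> 'I_n -> algC) : Prop :=
  (forall i j k, T i j k = T j i k) /\ (forall i j k, T i j k = T i k j).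

Section Trilinear.

Variable T : 'I_n -> 'I_n -> 'I_n -> algC.
Hypothesis Tsym : symmetric_tensor T.

Local Notation t := (trilinear T).

Lemma trilinear_swap12 x y z : t x y z = t y x z.
Proof.
rewrite /trilinear exchange_big; apply: eq_bigr => i _; apply: eq_bigr => j _.
by apply: eq_bigr => k _; rewrite Tsym.1 [y _ * _]mulrC.
Qed.

Lemma trilinear_swap23 x y z : t x y z = t x z y.
Proof.
rewrite /trilinear; apply: eq_bigr => i _; rewrite exchange_big.
apply: eq_bigr => j _; apply: eq_bigr => k _.
by rewrite Tsym.2 mulrAC.
Qed.

Lemma trilinear_lincomb3 a b x y z z' :
  t x y (lincomb a z b z') = a * t x y z + b * t x y z'.
Proof.
rewrite /trilinear !big_distrr -big_split; apply: eq_bigr => i _ /=.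
rewrite !big_distrr -big_split; apply: eq_bigr => j _ /=.
rewrite !big_distrr -big_split; apply: eq_bigr => k _ /=.
by rewrite /lincomb; ring.
Qed.

Lemma trilinear_lincomb2 a b x y y' z :
  t x (lincomb a y b y') z = a * t x y z + b * t x y' z.
Proof. by rewrite trilinear_swap23 trilinear_lincomb3 !(trilinear_swap23 x z).
  Qed.

Lemma trilinear_lincomb1 a b x x' y z :
  t (lincomb a x b x') y z = a * t x y z + b * t x' y z.
Proof. by rewrite trilinear_swap12 trilinear_lincomb2 !(trilinear_swap12 y).
  Qed.

Definition trilinear_lincomb :=
  (trilinear_lincomb1, trilinear_lincomb2, trilinear_lincomb3).

Lemma trilinear_unit x y k :
  t x y (unit_vec k) = \sum_(i < n) \sum_(j < n) T i j k * (x i * y j).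
Proof.
apply: eq_bigr => i _; apply: eq_bigr => j _; rewrite (bigD1 k) //= big1.
  by rewrite addr0 /unit_vec eqxx mulr1.
by move=> l /negPf lk; rewrite /unit_vec lk !mulr0.
Qed.

Lemma trilinear_sum_unit x y z :
  t x y z = \sum_(k < n) z k * t x y (unit_vec k).
Proof.
under [RHS]eq_bigr => k _ do rewrite trilinear_unit big_distrr /=.
rewrite exchange_big; apply: eq_bigr => i _ /=.
under [RHS]eq_bigr => k _ do rewrite big_distrr /=.
rewrite exchange_big; apply: eq_bigr => j _ /=.
by apply: eq_bigr => k _; ring.
Qed.

End Trilinear.

Lemma polyfun_trilinear m T (x y z : 'I_n -> ('I_m -> algC) -> algC) :
  (forall i, polyfun (x i)) -> (forall i, polyfun (y i)) ->
  (forall i, polyfun (z i)) ->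
  polyfun (fun v => trilinear T (x^~ v) (y^~ v) (z^~ v)).
Proof.
move=> xP yP zP; do 3!(apply: polyfun_sum => ?).
by do !apply: polyfunM => //; apply: polyfunC.
Qed.

Lemma polyfun_diag T (x y z : bool) (a b c : 'I_n -> algC) :
  polyfun (fun u : 'I_n -> algC =>
    trilinear T (if x then u else a) (if y then u else b) (if z then u else c)).
Proof.
apply: (eq_polyfun (phi := fun u => trilinear T (fun i => if x then u i else a
  i)
  (fun i => if y then u i else b i) (fun i => if z then u i else c i))).
  by move=> u; case: x y z => [] [] [].
apply: (polyfun_trilinear T (x := fun i u => if x then u i else a i)
  (y := fun i u => if y then u i else b i)
  (z := fun i u => if z then u i else c i)) => i.
- by case: x; [apply: polyfun_coord | apply: polyfunC].
- by case: y; [apply: polyfun_coord | apply: polyfunC].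
- by case: z; [apply: polyfun_coord | apply: polyfunC].
Qed.

End CubicForms.

(** * Euler identity and the polar form of a cubic *)

Section Euler.

Variable n : nat.
Implicit Type p : {mpoly algC[n]}.

Lemma dhomog_mderiv d p i : p \is d.+1.-homog -> p^`M(i) \is d.-homog.
Proof.
move=> /dhomogP pH; apply/dhomogP => m; rewrite mcoeff_msupp mcoeff_deriv.
move=> mN0; have /pH : (m + U_(i))%MM \in msupp p.
  by rewrite mcoeff_msupp; apply: contraNneq mN0 => ->; rewrite mul0rn.
by rewrite /= mdegD mdeg1 addn1 => -[].
Qed.

Lemma meval_dhomog0 p x y : p \is 0.-homog -> p.@[x] = p.@[y].
Proof.
move=> /dhomogP pH; suff -> : p = (p@_0%MM)%:MP by rewrite !mevalC.
apply/mpolyP => m; rewrite mcoeffC; have [->|mN0] := eqVneq m 0%MM.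
  by rewrite mulr1.
rewrite mulr0 memN_msupp_eq0 //; apply: contraNN mN0 => /pH.
by move=> /eqP; rewrite mdeg_eq0.
Qed.

Lemma euler_identity d p x : p \is d.-homog ->
  \sum_(i < n) x i * (p^`M(i)).@[x] = d%:R * p.@[x].
Proof.
move=> /dhomogP pH.
have Dp i : (p^`M(i)).@[x] = \sum_(m <- msupp p) (p@_m *: 'X_[m])^`M(i).@[x].
  by rewrite {1}[p]mpolyE (raddf_sum (mderiv i)) /= (raddf_sum (meval x));
    apply: eq_bigr.
rewrite {2}[p]mpolyE (raddf_sum (meval x)) big_distrr /=.
under eq_bigr => i _ do rewrite Dp big_distrr /=.
rewrite exchange_big /= big_seq [RHS]big_seq.
apply: eq_bigr => m /pH /= <-; rewrite mdegE natr_sum big_distrl /=.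
apply: eq_bigr => i _.
rewrite mderivZ mderivX !mevalZ; have [->|miN0] := eqVneq (m i) 0%N.
  by rewrite !mul0r !mulr0.
have -> : 'X_[m].@[x] = 'X_[m - U_(i)].@[x] * x i.
  by rewrite -[in LHS](@submK _ U_(i)%MM m) ?lep1mP // mpolyXD mevalM mevalXU.
by ring.
Qed.

(** By Euler's identity the third derivatives, which are constants, determine
    the cubic and its gradient. *)
Lemma cubic_polar_form c : c \is 3.-homog ->
  exists2 T : 'I_n -> 'I_n -> 'I_n -> algC, symmetric_tensor T &
    (forall x, c.@[x] = trilinear T x x x) /\
    (forall i x, (c^`M(i)).@[x] = 3%:R * trilinear T x x (unit_vec i)).
Proof.
move=> cH; pose T i j k := (c^`M(i)^`M(j)^`M(k)).@[fun=> 0] / 6%:R.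
have c1 i : c^`M(i) \is 2.-homog by apply: dhomog_mderiv.
have c2 i j : c^`M(i)^`M(j) \is 1.-homog by apply: dhomog_mderiv.
have c3 i j k : c^`M(i)^`M(j)^`M(k) \is 0.-homog by apply: dhomog_mderiv.
have six : (6%:R : algC) != 0 by rewrite pnatr_eq0.
have T3 x i j k : (c^`M(i)^`M(j)^`M(k)).@[x] = 6%:R * T i j k.
  by rewrite /T mulrCA divff // mulr1; apply: meval_dhomog0.
have D1 i x : (c^`M(i)).@[x] = 3%:R * trilinear T x x (unit_vec i).
  apply: (@mulfI _ 2%:R); first by rewrite pnatr_eq0.
  rewrite -(euler_identity x (c1 i)) trilinear_unit mulrA big_distrr.
  apply: eq_bigr => j _; have := euler_identity x (c2 i j).
  rewrite mul1r => <-; rewrite !big_distrr; apply: eq_bigr => k _ /=.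
  rewrite T3 (_ : T i j k = T j k i); first by ring.
  by rewrite /T (mderiv_comm i j c) (mderiv_comm i k).
exists T; first split=> i j k.
- by rewrite /T (mderiv_comm i j c).
- by rewrite /T (mderiv_comm j k).
split=> // x; apply: (@mulfI _ 3%:R); first by rewrite pnatr_eq0.
rewrite -(euler_identity x cH) trilinear_sum_unit big_distrr.
by apply: eq_bigr => i _ /=; rewrite D1 mulrCA.
Qed.

End Euler.

(** * Roots of polynomials of degree at most three *)

Lemma algC_root2 (a b c : algC) : a != 0 ->
  exists s, a * s ^+ 2 + b * s + c = 0.
Proof.
move=> a0; have /closed_rootP[s] : size (Poly [:: c; b; a]) != 1%N.
  by rewrite (@PolyK _ 0).
by rewrite /root horner_Poly /= => /eqP E; exists s; rewrite -[RHS]E; ring.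
Qed.

Lemma algC_root3 (a b c d : algC) : a != 0 ->
  exists s, a * s ^+ 3 + b * s ^+ 2 + c * s + d = 0.
Proof.
move=> a0; have /closed_rootP[s] : size (Poly [:: d; c; b; a]) != 1%N.
  by rewrite (@PolyK _ 0).
by rewrite /root horner_Poly /= => /eqP E; exists s; rewrite -[RHS]E; ring.
Qed.

Lemma quadratic_eq0 (a b c : algC) (rs : seq algC) :
  uniq rs -> (2 < size rs)%N ->
  (forall r, r \in rs -> a * r ^+ 2 + b * r + c = 0) -> [/\ a = 0, b = 0 & c =
    0].
Proof.
move=> rsU rs3 rsP; pose p := Poly [:: c; b; a].
have p0 : p = 0.
  apply/eqP; apply: contraTT rs3 => pN0; rewrite -leqNgt -ltnS.
  apply: leq_trans (size_Poly [:: c; b; a]).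
  apply: max_poly_roots => //; apply/allP => r /rsP E.
  by rewrite /root horner_Poly /=; apply/eqP; rewrite -[RHS]E; ring.
have coefp k : p`_k = 0 by rewrite p0 coef0.
by have := (coefp 0%N, coefp 1%N, coefp 2%N); rewrite !coef_Poly => -[[]].
Qed.

Lemma cubic_distinct_roots (a b c d : algC) : a != 0 ->
  b ^+ 2 * c ^+ 2 - 4%:R * a * c ^+ 3 - 4%:R * b ^+ 3 * d
    - 27%:R * a ^+ 2 * d ^+ 2 + 18%:R * a * b * c * d != 0 ->
  exists rs, [/\ uniq rs, size rs = 3 &
    forall r, r \in rs -> a * r ^+ 3 + b * r ^+ 2 + c * r + d = 0].
Proof.
move=> a0; have [r1 Er1] := algC_root3 b c d a0.
have [r2 Er2] := algC_root2 (b + a * r1) (c + (b + a * r1) * r1) a0.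
pose r3 := - (b + a * r1) / a - r2.
have Eb : b = - (a * (r1 + r2 + r3)) by rewrite /r3; field.
clearbody r3.
have Ec : c = a * (r1 * r2 + r1 * r3 + r2 * r3).
  by apply/eqP; rewrite -subr_eq0 -Er2 Eb; apply/eqP; ring.
have Ed : d = - (a * r1 * r2 * r3).
  by apply/eqP; rewrite -subr_eq0 -Er1 Ec Eb; apply/eqP; ring.
subst b c d.
set disc := (X in X != 0).
have -> : disc = a ^+ 4 * ((r1 - r2) * (r1 - r3) * (r2 - r3)) ^+ 2.
  by rewrite /disc; ring.
move=> dN0.
have r12 : r1 != r2 by apply: contraNneq dN0 => ->; apply/eqP; ring.
have r13 : r1 != r3 by apply: contraNneq dN0 => ->; apply/eqP; ring.
have r23 : r2 != r3 by apply: contraNneq dN0 => ->; apply/eqP; ring.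
exists [:: r1; r2; r3]; split => //=.
  by rewrite !inE negb_or r12 r13 r23.
by move=> r; rewrite !inE => /or3P[] /eqP ->; ring.
Qed.

(** * Inflectional tangents of cubic surfaces *)

Section CubicThreefold.

Variable T : 'I_4 -> 'I_4 -> 'I_4 -> algC.
Hypothesis Tsym : symmetric_tensor T.
Hypothesis Tsmooth : forall x : 'I_4 -> algC, nonzero_vec x ->
  exists k, trilinear T x x (unit_vec k) != 0.

Local Notation t := (trilinear T).
Local Notation lin := (trilinear_lincomb Tsym).

Let t12 := trilinear_swap12 Tsym.
Let t23 := trilinear_swap23 Tsym.

Lemma cubic_zero_exists : exists2 q, nonzero_vec q & t q q q = 0.
Proof.
pose e0 := unit_vec (ord0 : 'I_4); pose e1 := unit_vec (ord_max : 'I_4).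
have [E|N0] := eqVneq (t e1 e1 e1) 0.
  by exists e1 => //; exists ord_max; rewrite /e1 /unit_vec eqxx oner_eq0.
have [s Es] := algC_root3 (3%:R * t e0 e1 e1) (3%:R * t e0 e0 e1)
  (t e0 e0 e0) N0.
exists (lincomb 1 e0 s e1).
  exists ord0; rewrite /lincomb /e0 /e1 /unit_vec eqxx.
  by rewrite (_ : (ord0 == ord_max :> 'I_4) = false) // mulr0 addr0 mulr1
    oner_eq0.
rewrite -[RHS]Es !lin (t12 e1 e0) (t23 e0 e1 e0) (t23 e1 e1 e0) (t12 e1 e0).
by ring.
Qed.

(** In the tangent plane at a point [q] of the cubic surface, the second order
    term of the equation is a binary quadratic form modulo [q]; a zero [v] of it
    spans with [q] a line that meets the surface only at [q], with multiplicity
    three, or is contained in it. *)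
Lemma osculating_line_exists :
  exists q v, [/\ nonzero_vec q, t q q q = 0, t q q v = 0, t q v v = 0 &
    forall s, nonzero_vec (lincomb s q 1 v)].
Proof.
have [q q0 tq] := cubic_zero_exists.
have [k lk] := Tsmooth q0.
pose l j := t q q (unit_vec j); rewrite -/(l k) in lk.
have [j0 j0k qj0] : exists2 j0, j0 != k & q j0 != 0.
  apply: NNPP => no; have qE j : j != k -> q j = 0.
    by move=> jk; apply/eqP; apply: contraT => qj; case: no; exists j.
  have := tq; rewrite trilinear_sum_unit (bigD1 k) //= big1 => [|j /qE -> //].
    move=> /eqP; rewrite addr0 mulf_eq0 (negPf lk) orbF => /eqP qk.
    case: q0 => i; have [->|/qE->] := eqVneq i k; by rewrite ?qk eqxx.
  by rewrite mul0r.
have [j1 [j2 [j12 j1k j2k j10 j20]]] : exists j1 j2 : 'I_4,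
    [/\ j1 != j2, j1 != k, j2 != k, j1 != j0 & j2 != j0].
  have /cards2P[j1 [j2 [j12 E]]] : #|~: [set k; j0]| == 2.
    by rewrite cardsCs setCK card_ord cards2 (eq_sym k) j0k.
  have : j1 \in ~: [set k; j0] by rewrite E !inE eqxx.
  have : j2 \in ~: [set k; j0] by rewrite E !inE eqxx orbT.
  by rewrite !inE !negb_or => /andP[? ?] /andP[? ?]; exists j1, j2.
(* The vectors [w j], for [j != k], form a basis of the tangent plane.  As [q]
   has a non-zero coordinate on [w j0], it is independent of [w j1] and [w j2]. *)
pose w j := lincomb 1 (unit_vec j) (- (l j / l k)) (unit_vec k).
have tw j : t q q (w j) = 0.
  by rewrite /w lin -/(l j) -/(l k) mulNr divfK // mul1r subrr.
have indep v j : t q q v = 0 -> t q v v = 0 -> j != k -> j != j0 ->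
    v j0 = 0 -> v j != 0 -> exists q v, [/\ nonzero_vec q, t q q q = 0,
      t q q v = 0, t q v v = 0 & forall s, nonzero_vec (lincomb s q 1 v)].
  move=> tv tvv jk jj0 vj0 vj; exists q, v; split=> // s.
  have [->|s0] := eqVneq s 0.
    by exists j; rewrite /lincomb mul0r add0r mul1r.
  by exists j0; rewrite /lincomb vj0 mulr0 addr0 mulf_neq0.
have wE i j : j != k -> w i j = (j == i)%:R.
  by move=> jk; rewrite /w /lincomb /unit_vec (negPf jk) mulr0 addr0 mul1r.
clearbody w.
have [E|N0] := eqVneq (t q (w j2) (w j2)) 0.
  apply: (indep (w j2) j2) => //.
    by rewrite wE // eq_sym (negPf j20).
  by rewrite wE // eqxx oner_eq0.
have [s Es] := algC_root2 (2%:R * t q (w j1) (w j2)) (t q (w j1) (w j1)) N0.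
apply: (indep (lincomb 1 (w j1) s (w j2)) j1) => //.
- by rewrite lin !tw; ring.
- by rewrite -[RHS]Es !lin (t23 q (w j2)); ring.
- by rewrite /lincomb !wE // ![j0 == _]eq_sym (negPf j10) (negPf j20) !mulr0
  addr0.
- by rewrite /lincomb !wE // eqxx (negPf j12) mulr0 addr0 mulr1 oner_eq0.
Qed.

End CubicThreefold.

(** * Subfields and rational points of cubic threefolds *)

(** Subfields of [algC] are propositional predicates here, as the range of an
    embedding of a number field is not given by a decision procedure. *)
Record subfield_pred (K : algC -> Prop) : Prop := SubfieldPred {
  subfield1 : K 1;
  subfieldB : forall x y, K x -> K y -> K (x - y);
  subfieldM : forall x y, K x -> K y -> K (x * y);
  subfieldV : forall x, K x -> K x^-1
}.

Section SubfieldClosure.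

Variable K : algC -> Prop.
Hypothesis KF : subfield_pred K.

Lemma subfield0 : K 0.
Proof. by rewrite -(subrr 1); apply: subfieldB => //; apply: subfield1. Qed.

Lemma subfieldN x : K x -> K (- x).
Proof. by move=> Kx; rewrite -sub0r; apply: subfieldB => //; apply: subfield0.
  Qed.

Lemma subfieldD x y : K x -> K y -> K (x + y).
Proof.
by move=> Kx Ky; rewrite -[y]opprK; apply: subfieldB => //; apply: subfieldN.
Qed.

Lemma subfield_nat k : K k%:R.
Proof.
elim: k => [|k IHk]; first exact: subfield0.
by rewrite -addn1 natrD; apply: subfieldD => //; apply: subfield1.
Qed.

Lemma subfieldX x k : K x -> K (x ^+ k).
Proof.
move=> Kx; elim: k => [|k IHk]; first exact: subfield1.
by rewrite exprS; apply: subfieldM.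
Qed.

End SubfieldClosure.

Section DenseCubes.

Variable T : 'I_4 -> 'I_4 -> 'I_4 -> algC.
Hypothesis Tsym : symmetric_tensor T.
Hypothesis Tsmooth : forall x : 'I_4 -> algC, nonzero_vec x ->
  exists k, trilinear T x x (unit_vec k) != 0.

Local Notation t := (trilinear T).
Local Notation lin := (trilinear_lincomb Tsym).

Let t12 := trilinear_swap12 Tsym.
Let t23 := trilinear_swap23 Tsym.

Variables (q v : 'I_4 -> algC) (w0 : algC).
Hypotheses (tqqq : t q q q = 0) (tqqv : t q q v = 0) (tqvv : t q v v = 0).
Hypothesis tvvv : t v v v = w0 ^+ 3.

Section LineMap.

Variables (s : algC) (k : 'I_4) (x : 'I_4 -> algC) (w : algC).

Let a := lincomb s q 1 v.
Let kappa := t a a (unit_vec k).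
Let b := lincomb kappa x (w0 ^+ 2 * w - t a a x) (unit_vec k).
Let g := t b b b - (kappa * w) ^+ 3.
Let m := t b b a - (kappa * w) ^+ 2 * w0.

(** The point [(a, w0)] runs over a line of the threefold [c(x) = w ^ 3], and
    [(b, kappa * w)] is a tangent vector at that point: the projection of
    [(x, w)] along [(unit_vec k, 0)].  The tangent line meets the threefold in
    one more point, whose coordinates are [line_map] and [line_map_root]. *)
Definition line_map : 'I_4 -> algC := lincomb g a (- 3%:R * m) b.
Definition line_map_root : algC := g * w0 - 3%:R * m * (kappa * w).

Lemma line_map_cube : t line_map line_map line_map = line_map_root ^+ 3.
Proof.
have taaa : t a a a = w0 ^+ 3.
  rewrite /a !lin tqqq (t12 v) (t23 q v q) tqqv (t23 v v q) (t12 v q) tqvv tvvv.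
  by ring.
have taab : t a a b = w0 ^+ 2 * (kappa * w) by rewrite /b lin -/kappa; ring.
have tb : t b b b = g + (kappa * w) ^+ 3 by rewrite /g subrK.
have tm : t b b a = m + (kappa * w) ^+ 2 * w0 by rewrite /m subrK.
rewrite /line_map /line_map_root; clearbody a b g m kappa.
rewrite !lin (t12 b a a) (t23 a b a) (t12 a b b) (t23 b a b).
by rewrite taaa taab tb tm; ring.
Qed.

End LineMap.

(** The line map as a function of six parameters: the position on the line, the
    last coordinate [w], and the four coordinates of [x]. *)
Definition line_map_params (u : 'I_6 -> algC) (i : 'I_4) : algC :=
  u (lift ord0 (lift ord0 i)).

Lemma line_map_polyfun k i : polyfun (fun u : 'I_6 -> algC =>
  line_map (u ord0) k (line_map_params u) (u (lift ord0 ord0)) i).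
Proof.
have Pu j : polyfun (fun u : 'I_6 -> algC => u j) by exact: polyfun_coord.
have Pc c : polyfun (fun u : 'I_6 -> algC => c) by exact: polyfunC.
have Px j : polyfun (fun u : 'I_6 -> algC => line_map_params u j) by exact: Pu.
pose a (j : 'I_4) (u : 'I_6 -> algC) := lincomb (u ord0) q 1 v j.
have Pa j : polyfun (a j) by apply: polyfunD; apply: polyfunM.
pose kappa (u : 'I_6 -> algC) := t (a^~ u) (a^~ u) (unit_vec k).
have Pk : polyfun kappa.
  by apply: (polyfun_trilinear T Pa Pa (z := fun j _ => unit_vec k j)) => j.
pose W (u : 'I_6 -> algC) := u (lift ord0 ord0).
pose b (j : 'I_4) u := lincomb (kappa u) (line_map_params u)
  (w0 ^+ 2 * W u - t (a^~ u) (a^~ u) (line_map_params u)) (unit_vec k) j.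
have Pb j : polyfun (b j).
  apply: polyfunD; apply: polyfunM => //; apply: polyfunD.
    by apply: polyfunM; [exact: Pc | exact: Pu].
  apply: polyfunN.
  exact: (polyfun_trilinear T Pa Pa (z := fun j u => line_map_params u j)).
have PkW : polyfun (fun u => kappa u * W u).
  by apply: polyfunM => //; exact: Pu.
have Pg : polyfun (fun u => t (b^~ u) (b^~ u) (b^~ u) - (kappa u * W u) ^+ 3).
  apply: polyfunD; first exact: polyfun_trilinear.
  by apply/polyfunN/polyfunX.
have Pm : polyfun (fun u => t (b^~ u) (b^~ u) (a^~ u) - (kappa u * W u) ^+ 2 *
  w0).
  apply: polyfunD; first exact: polyfun_trilinear.
  by apply/polyfunN/polyfunM => //; apply: polyfunX.
apply: polyfunD; apply: polyfunM; [exact: Pg | exact: Pa | | exact: Pb].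
by apply: polyfunM; [exact: Pc | exact: Pm].
Qed.

(** The line map is invertible where the polar quadric of [(x, w)] meets the
    line in two distinct points: given a point [(x, w)] of the threefold, it is
    the third point on the line joining it to either of them. *)
Lemma line_map_onto x w :
  (forall s, nonzero_vec (lincomb s q 1 v)) ->
  t x x x = w ^+ 3 -> t q q x != 0 -> t x x q != 0 ->
  t q v x ^+ 2 - t q q x * (t v v x - w0 ^+ 2 * w) != 0 ->
  exists s k r, line_map s k (fun i => r * x i) (r * w) =1 x.
Proof.
set al := t q q x; set be := t q v x; set ga := t v v x - w0 ^+ 2 * w.
move=> lineN0 txxx al0 txxq disc.
have := sqrtCK (be ^+ 2 - al * ga); set rt := sqrtC _ => rtE.
have rt0 : rt != 0.
  by apply: contraNneq disc => E; rewrite -rtE E expr0n.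
pose a s := lincomb s q 1 v.
pose chi s := t x x (a s) - w ^+ 2 * w0.
have [s [sroot chis]] : exists s, al * s ^+ 2 + 2%:R * be * s + ga = 0 /\ chi s
  != 0.
  have root e : e ^+ 2 = 1 ->
      al * ((e * rt - be) / al) ^+ 2 + 2%:R * be * ((e * rt - be) / al) + ga =
        0.
    move=> e1; apply: (mulfI al0); rewrite mulr0.
    transitivity (e ^+ 2 * rt ^+ 2 - (be ^+ 2 - al * ga)); first by field.
    by rewrite e1 rtE mul1r subrr.
  have [E|] := eqVneq (chi ((1 * rt - be) / al)) 0; last first.
    by exists ((1 * rt - be) / al); rewrite root ?expr1n.
  exists ((-1 * rt - be) / al); split; first by rewrite root // sqrrN expr1n.
  apply: contraNneq txxq => E'.
  have : chi ((1 * rt - be) / al) - chi ((-1 * rt - be) / al) = 0.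
    by rewrite E E' subrr.
  rewrite /chi /a !lin => {}E; apply/eqP/(@mulIf _ (2%:R * rt / al)).
    by rewrite !mulf_neq0 ?invr_eq0 ?pnatr_eq0.
  by rewrite mul0r -[RHS]E; field.
have [k kN0] := Tsmooth (lineN0 s); rewrite -/(a s) in kN0.
have Cw3 := rootCK (isT : 0 < 3)%N.
pose ka := t (a s) (a s) (unit_vec k).
pose r := 3.-root (- (3%:R * ka ^+ 3 * chi s)^-1).
have r3 : r ^+ 3 = - (3%:R * ka ^+ 3 * chi s)^-1 by apply: Cw3.
have taax : t (a s) (a s) x = w0 ^+ 2 * w.
  apply/eqP; rewrite -subr_eq0; apply/eqP; rewrite -[RHS]sroot /a !lin.
  by rewrite (t12 v q) /al /be /ga; ring.
have rx : (fun i => r * x i) = lincomb r x 0 x.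
  by apply: functional_extensionality => i; rewrite /lincomb mul0r addr0.
have bE : lincomb ka (fun i => r * x i)
    (w0 ^+ 2 * (r * w) - t (a s) (a s) (fun i => r * x i)) (unit_vec k) =
    lincomb (ka * r) x 0 x.
  apply: functional_extensionality => i; rewrite rx lin taax /lincomb.
  by ring.
exists s, k, r => i; rewrite /line_map -/(a s) -/ka bE.
have ka0 : ka != 0 := kN0.
rewrite [LHS]/lincomb /= !lin txxx.
transitivity (- (3%:R * ka ^+ 3 * chi s) * r ^+ 3 * x i).
  by rewrite /chi /a !lin /lincomb; ring.
by rewrite r3 mulrNN divff ?mul1r // !mulf_neq0 ?expf_neq0 ?pnatr_eq0.
Qed.



Lemma polar_form_neq0 (x : 'I_4 -> algC) : nonzero_vec x -> exists y, t x x y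
  != 0.
Proof. by move=> /Tsmooth[k kN0]; exists (unit_vec k). Qed.

(** A cubic form that vanished identically would have all its polar forms
    zero: compare the values at [y + z] and [y - z]. *)
Lemma cubic_value_neq0 (y : 'I_4 -> algC) : nonzero_vec y -> exists x, t x x x
  != 0.
Proof.
move=> /polar_form_neq0[z yyz]; apply: NNPP => no.
have c0 x : t x x x = 0.
  by apply/eqP; apply: contraT => xN0; case: no; exists x.
have := c0 (lincomb 1 y 1 z); have := c0 (lincomb 1 y (-1) z).
rewrite !lin !c0 (t12 z y y) (t23 y z y) (t12 y z z) (t23 z y z) => E1 E2.
case/eqP: yyz; apply: (@mulfI _ 6%:R); first by rewrite pnatr_eq0.
rewrite mulr0; have := congr2 (fun a b => a - b) E2 E1; rewrite subrr => <-.
by ring.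
Qed.

Lemma polar_quadric_neq0 (y : 'I_4 -> algC) : nonzero_vec y -> exists x, t x x
  y != 0.
Proof.
move=> y0; have [z yyz] := polar_form_neq0 y0; apply: NNPP => no.
have c0 x : t x x y = 0.
  by apply/eqP; apply: contraT => xN0; case: no; exists x.
have := c0 (lincomb 1 y 1 z).
rewrite !lin !c0 (t12 z y y) (t23 y z y) => /eqP.
rewrite !mul1r !addr0 add0r -mulr2n -mulr_natr mulf_eq0 pnatr_eq0 orbF.
by rewrite (negPf yyz).
Qed.

(** If the discriminant of the polar quadrics restricted to the line [q v]
    vanished identically, some polar quadric [t u u] with [u] on the line would
    vanish, i.e. [u] would be singular. *)
Lemma polar_disc_neq0 :
  nonzero_vec q -> (forall s, nonzero_vec (lincomb s q 1 v)) ->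
  exists x, t q v x ^+ 2 - t q q x * t v v x != 0.
Proof.
move=> /polar_form_neq0[x0 ax0] lineN0; apply: NNPP => no.
have disc0 x : t q v x ^+ 2 = t q q x * t v v x.
  by apply/eqP; rewrite -subr_eq0; apply: contraT => xN0; case: no; exists x.
pose r := t q v x0 / t q q x0.
have Eb x : t q v x = r * t q q x.
  apply/eqP; rewrite -subr_eq0 -sqrf_eq0; apply/eqP.
  pose y := lincomb 1 x (- (t q q x / t q q x0)) x0.
  have ay : t q q y = 0 by rewrite /y lin mul1r mulNr divfK ?subrr.
  have := disc0 y; rewrite ay mul0r {ay}/y lin /r => E.
  by rewrite -[RHS]E; field.
have Ed x : t q q x != 0 -> t v v x = r ^+ 2 * t q q x.
  move=> ax; apply: (mulfI ax); rewrite -disc0 Eb; ring.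
have Ed' x : t v v x = r ^+ 2 * t q q x.
  have [ax|/Ed//] := eqVneq (t q q x) 0; rewrite ax mulr0.
  have := Ed (lincomb 1 x0 1 x); rewrite !lin ax !mul1r addr0 => /(_ ax0).
  by rewrite Ed // => E; apply: (addrI (r ^+ 2 * t q q x0)); rewrite addr0.
have [y] := polar_form_neq0 (lineN0 (- r)).
by case/eqP; rewrite !lin (t12 v q) Eb Ed'; ring.
Qed.

(** The line map sends natural parameters to [K]-rational points of the
    threefold, so a polynomial that vanishes at these points vanishes on the
    image of the line map, which contains a non-empty open set. *)
Lemma cube_values_dense (K : algC -> Prop) (P : ('I_4 -> algC) -> algC) :
  subfield_pred K ->
  (forall x y z, (forall i, K (x i)) -> (forall i, K (y i)) ->
     (forall i, K (z i)) -> K (t x y z)) ->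
  (forall i, K (q i)) -> (forall i, K (v i)) -> K w0 ->
  nonzero_vec q -> (forall s, nonzero_vec (lincomb s q 1 v)) ->
  polyfun P ->
  (forall x w, (forall i, K (x i)) -> K w -> t x x x = w ^+ 3 -> P x = 0) ->
  forall x, P x = 0.
Proof.
move=> KF Kt Kq Kv Kw0 q0 lineN0 PP P0.
have Klin a x b y : K a -> (forall i, K (x i)) -> K b -> (forall i, K (y i)) ->
    forall i, K (lincomb a x b y i).
  by move=> Ka Kx Kb Ky i; apply: subfieldD => //; apply: subfieldM.
have Ke k i : K (unit_vec k i) by apply: subfield_nat.
have Kline s k x w : K s -> (forall i, K (x i)) -> K w ->
    (forall i, K (line_map s k x w i)) /\ K (line_map_root s k x w).
  move=> Ks Kx Kw; have K1 := subfield1 KF.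
  have Ka i : K (lincomb s q 1 v i) by apply: Klin.
  set kap := t (lincomb s q 1 v) (lincomb s q 1 v) (unit_vec k).
  have Kkap : K kap by apply: Kt.
  have Kb i : K (lincomb kap x (w0 ^+ 2 * w - t (lincomb s q 1 v)
      (lincomb s q 1 v) x) (unit_vec k) i).
    apply: Klin => //; apply: subfieldB => //; last exact: Kt.
    by apply: subfieldM => //; apply: subfieldX.
  rewrite /line_map /line_map_root -/kap; move: (lincomb kap _ _ _) Kb => b Kb.
  have Kg : K (t b b b - (kap * w) ^+ 3).
    by apply: subfieldB; rewrite ?exprMn; [|exact: Kt|];
      try apply: subfieldM; try apply: subfieldX.
  have Km : K (3%:R * (t b b (lincomb s q 1 v) - (kap * w) ^+ 2 * w0)).
    apply: subfieldM; [done|exact: subfield_nat|apply: subfieldB => //].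
      exact: Kt.
    by apply: subfieldM => //; apply: subfieldX => //; apply: subfieldM.
  split=> [i|].
    by apply: Klin => //; rewrite mulNr; apply: subfieldN.
  by apply: subfieldB => //; apply: subfieldM => //; apply: subfieldM.
have line0 k u : P (line_map (u ord0) k (line_map_params u) (u (lift ord0
  ord0))) = 0.
  move: u; apply: polyfun_eq0_nat.
    have [Q EQ] := PP.
    apply: (eq_polyfun (phi := fun u => Q.@[fun i =>
      line_map (u ord0) k (line_map_params u) (u (lift ord0 ord0)) i])).
      by move=> u; rewrite EQ.
    by apply: polyfun_meval => i; apply: line_map_polyfun.
  move=> u; set s := _%:R; set w := _%:R; set x := line_map_params _.
  have [||| Kx Kw] := @Kline s k x w; try (move=> *; exact: subfield_nat).
  exact: P0 Kx Kw (line_map_cube _ _ _ _).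
have onto x w : t x x x = w ^+ 3 -> t q q x != 0 -> t x x q != 0 ->
    t q v x ^+ 2 - t q q x * (t v v x - w0 ^+ 2 * w) != 0 -> P x = 0.
  move=> txxx qqx xxq disc.
  have [s [k [r E]]] := line_map_onto lineN0 txxx qqx xxq disc.
  pose u (j : 'I_6) := if unlift ord0 j is Some j' then
    (if unlift ord0 j' is Some i then r * x i else r * w) else s.
  have := line0 k u; rewrite /u /line_map_params unlift_none liftK unlift_none.
  rewrite (_ : (fun i => _) = (fun i => r * x i)); last first.
    by apply: functional_extensionality => i; rewrite !liftK.
  by rewrite (functional_extensionality _ _ E).
pose D x := t x x x * (t q q x * (t x x q *
  (if w0 == 0 then t q v x ^+ 2 - t q q x * t v v x else 1))).
have Pxxx : polyfun (fun x => t x x x) := polyfun_diag T true true true q q q.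
have Pqqx : polyfun (fun x => t q q x) := polyfun_diag T false false true q q q.
have Pxxq : polyfun (fun x => t x x q) := polyfun_diag T true true false q q q.
have Pvvx : polyfun (fun x => t v v x) := polyfun_diag T false false true v v q.
have Pqvx : polyfun (fun x => t q v x) := polyfun_diag T false false true q v q.
have Pdisc : polyfun (fun x => if w0 == 0 then
    t q v x ^+ 2 - t q q x * t v v x else 1).
  case: eqP => _; last exact: polyfunC.
  by apply: polyfunD; [apply: polyfunX|apply/polyfunN/polyfunM].
have [x xN0] : exists x, D x != 0.
  apply: polyfun_mul_neq0 => //; first by do 2?apply: polyfunM.
    exact: cubic_value_neq0 q0.
  apply: polyfun_mul_neq0 => //; first by apply: polyfunM.
    exact: polar_form_neq0.
  apply: polyfun_mul_neq0 => //; first exact: polar_quadric_neq0.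
  by case: eqP => _; [exact: polar_disc_neq0 | exists q; rewrite oner_eq0].
apply: (polyfun_mul_eq0 PP (psi := D) _ _ xN0); first by do 3?apply: polyfunM.
move=> {xN0}x; have [->|] := eqVneq (D x) 0; first by rewrite mulr0.
rewrite /D !mulf_eq0 !negb_or => /and4P[xxx qqx xxq disc].
suff -> : P x = 0 by rewrite mul0r.
have := rootCK (isT : 0 < 3)%N (t x x x); set w := 3.-root _ => w3.
have wN0 : w != 0 by apply: contraNneq xxx => E; rewrite -w3 E expr0n.
have [w0E|w0N0] := eqVneq w0 0.
  by apply: (onto x w) => //; move: disc; rewrite w0E eqxx expr0n mul0r subr0.
(* The three cube roots of the value at [x] give different discriminants. *)
have [e e3] := C_prim_root_exists (isT : 0 < 3)%N.
have [E|dw] := eqVneq (t q v x ^+ 2 - t q q x * (t v v x - w0 ^+ 2 * w)) 0.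
  apply: (onto x (e * w)) => //.
    by rewrite exprMn (prim_expr_order e3) mul1r w3.
  have ne : (e == 1) = false by have := eq_prim_root_expr e3 1 0.
  apply: contraFneq ne => E'.
  have : t q q x * w0 ^+ 2 * w * (e - 1) = 0.
    by rewrite -[RHS](subrr 0) -{1}E' -E; ring.
  move=> /eqP; rewrite !mulf_eq0 (negPf qqx) !(negPf w0N0) (negPf wN0).
  by rewrite subr_eq0.
exact: (onto x w).
Qed.

End DenseCubes.

(** * Restriction of polynomials to lines *)

Section LinePoly.

Variable n : nat.
Implicit Type P : {mpoly algC[n]}.

Definition line_poly P (x y : 'I_n -> algC) : {poly algC} :=
  mmap (@polyC algC) (fun i => (x i)%:P + y i *: 'X) P.

Lemma horner_line_poly P x y s :
  (line_poly P x y).[s] = P.@[lincomb 1 x s y].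
Proof.
rewrite /line_poly /mmap horner_sum mevalE; apply: eq_bigr => m _.
rewrite hornerM hornerC horner_prod; congr (_ * _); apply: eq_bigr => i _.
by rewrite horner_exp hornerD hornerC hornerZ hornerX /lincomb mul1r mulrC.
Qed.

Lemma size_line_poly P x y : (size (line_poly P x y) <= msize P)%N.
Proof.
rewrite /line_poly /mmap big_seq.
elim/big_rec: _ => [|m p /msize_mdeg_lt mP IHp]; first by rewrite size_poly0.
apply: leq_trans (size_polyD _ _) _; rewrite geq_max {}IHp andbT.
apply: leq_trans mP; rewrite mul_polyC; apply: leq_trans (size_scale_leq _ _) _.
apply: leq_trans (size_prod_leq _ _) _; rewrite leq_subLR.
rewrite addnS ltnS mdegE -sum1_card -big_split /=.
apply: leq_sum => i _; apply: leq_trans (size_exp_leq _ _) _.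
rewrite add1n ltnS -[X in (_ <= X)%N]mul1n leq_mul2r; apply/orP; right.
rewrite -subn1 leq_subLR; apply: leq_trans (size_polyD _ _) _.
rewrite geq_max (leq_trans (size_polyC_leq1 _)) //=.
by apply: leq_trans (size_scale_leq _ _) _; rewrite size_polyX.
Qed.

End LinePoly.

(** * Quartics that vanish on a smooth cubic surface *)

Section DivisionByCubic.

Variable T : 'I_4 -> 'I_4 -> 'I_4 -> algC.
Hypothesis Tsym : symmetric_tensor T.
Hypothesis Tsmooth : forall x : 'I_4 -> algC, nonzero_vec x ->
  exists k, trilinear T x x (unit_vec k) != 0.

Local Notation t := (trilinear T).
Local Notation lin := (trilinear_lincomb Tsym).

Let t12 := trilinear_swap12 Tsym.
Let t23 := trilinear_swap23 Tsym.

Lemma common_zero_of_two_linear_forms (l1 l2 : 'I_4 -> algC) :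
  exists u : 'I_4 -> algC, [/\ nonzero_vec u, \sum_i u i * l1 i = 0 &
    \sum_i u i * l2 i = 0].
Proof.
pose A : 'M[algC]_(4, 2) := \matrix_(i, j) if j == 0 then l1 i else l2 i.
have : kermx A != 0.
  by rewrite -mxrank_eq0 mxrank_ker subn_eq0 -ltnNge ltnS (leq_trans
    (rank_leq_col _)).
case/rowV0Pn => u /sub_kermxP uA u0; exists (u 0); split.
- apply: NNPP => no; case/eqP: u0; apply/rowP => i; rewrite mxE.
  by apply/eqP; apply: contraT => ui; case: no; exists i.
- have /rowP/(_ 0) := uA; rewrite !mxE => E; rewrite -[RHS]E.
  by apply: eq_bigr => i _; rewrite mxE.
- have /rowP/(_ 1) := uA; rewrite !mxE => E; rewrite -[RHS]E.
  by apply: eq_bigr => i _; rewrite mxE.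
Qed.

(** The lines through a point [q] of the surface are not all tangent to it at
    some further point: otherwise the equation would be [a m ^ 2] for two linear
    forms [a] and [m], and the surface would be singular along [a = m = 0]. *)
Lemma transversal_direction_exists q : nonzero_vec q -> t q q q = 0 ->
  exists d, [/\ t d d d != 0, t q q d != 0 &
    3%:R * t q d d ^+ 2 - 4%:R * t d d d * t q q d != 0].
Proof.
move=> q0 tqqq.
have Pddd : polyfun (fun d => t d d d) := polyfun_diag T true true true q q q.
have Pqqd : polyfun (fun d => t q q d) := polyfun_diag T false false true q q q.
have Pqdd : polyfun (fun d => t q d d) := polyfun_diag T false true true q q q.
have Pdisc : polyfun (fun d => 3%:R * t q d d ^+ 2 - 4%:R * t d d d * t q q d).
  apply: polyfunD; first by apply: polyfunM; [apply: polyfunC | apply: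
    polyfunX].
  apply/polyfunN/polyfunM => //; apply: polyfunM => //; exact: polyfunC.
suff disc : exists d, 3%:R * t q d d ^+ 2 - 4%:R * t d d d * t q q d != 0.
  have := polyfun_mul_neq0 Pddd (polyfunM Pqqd Pdisc)
    (cubic_value_neq0 Tsym Tsmooth q0)
    (polyfun_mul_neq0 Pqqd Pdisc (polar_form_neq0 Tsmooth q0) disc).
  by case=> d; rewrite !mulf_eq0 !negb_or => /and3P[]; exists d.
apply: NNPP => no.
have disc0 d : 3%:R * t q d d ^+ 2 = 4%:R * t d d d * t q q d.
  by apply/eqP; rewrite -subr_eq0; apply: contraT => dN0; case: no; exists d.
have [x0 ax0] := polar_form_neq0 Tsmooth q0.
have Qker d : t q q d = 0 -> t q d d = 0.
  move=> ad; apply/eqP; have := disc0 d; rewrite ad mulr0 => /eqP.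
  by rewrite mulf_eq0 sqrf_eq0 pnatr_eq0.
pose al := 2%:R / t q q x0; pose be := - (t q x0 x0 / t q q x0 ^+ 2).
pose m d := al * t q x0 d + be * t q q d.
have Qam d : t q d d = t q q d * m d.
  have := Qker (lincomb 1 d (- (t q q d / t q q x0)) x0).
  rewrite !lin mul1r mulNr divfK // subrr => /(_ erefl) E.
  rewrite -[LHS]subr0 -[X in _ - X]E /m /al /be (t23 q d x0).
  by field.
have cam d : 4%:R * t d d d = 3%:R * t q q d * m d ^+ 2.
  apply/eqP; rewrite -subr_eq0; apply/eqP.
  have Pm : polyfun m.
    have Pqxd : polyfun (fun d => t q x0 d) := polyfun_diag T false false true
      q x0 q.
    by apply: polyfunD; apply: polyfunM => //; apply: polyfunC.
  move: d; apply: (polyfun_mul_eq0 _ Pqqd _ ax0).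
    apply: polyfunD; first by apply: polyfunM => //; apply: polyfunC.
    apply/polyfunN/polyfunM; last exact: polyfunX.
    by apply: polyfunM => //; apply: polyfunC.
  move=> d; rewrite mulrBl -disc0 Qam; ring.
have mE d : m d = \sum_i d i * m (unit_vec i).
  rewrite {1}/m !(trilinear_sum_unit T _ _ d) !big_distrr -big_split /=.
  by apply: eq_bigr => i _; rewrite /m; ring.
have [u [u0 au mu]] := common_zero_of_two_linear_forms
  (fun i => t q q (unit_vec i)) (fun i => m (unit_vec i)).
rewrite -mE in mu; rewrite -trilinear_sum_unit in au.
have [y] := polar_form_neq0 Tsmooth u0.
have mlin s : m (lincomb 1 u s y) = s * m y.
  move: mu; rewrite /m !lin au mulr0 addr0 => mu.
  transitivity (al * t q x0 u + s * (al * t q x0 y + be * t q q y)).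
    by ring.
  by rewrite mu add0r.
have := cam (lincomb 1 u 1 y); have := cam (lincomb 1 u (-1) y).
rewrite !mlin !lin au (t12 y u u) (t23 u y u) (t12 u y y) (t23 y u y).
have := cam y; have := cam u; rewrite au mulr0 mul0r => /eqP.
rewrite mulf_eq0 pnatr_eq0 => /eqP -> E0 E1 E2 /eqP[].
apply: (@mulfI _ 24%:R); first by rewrite pnatr_eq0.
have E := congr2 (fun a b => a - b) (congr2 (fun a b => a - b) E2 E1)
  (congr1 ( *%R 2%:R) E0).
have subE (A B z : algC) : A = B -> z = A - B -> z = 0.
  by move=> -> ->; rewrite subrr.
by rewrite mulr0; apply: subE E _; ring.
Qed.

End DivisionByCubic.

Section QuarticQuotient.

Variable T : 'I_4 -> 'I_4 -> 'I_4 -> algC.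
Hypothesis Tsym : symmetric_tensor T.
Hypothesis Tsmooth : forall x : 'I_4 -> algC, nonzero_vec x ->
  exists k, trilinear T x x (unit_vec k) != 0.

Local Notation t := (trilinear T).
Local Notation lin := (trilinear_lincomb Tsym).

Let t12 := trilinear_swap12 Tsym.
Let t23 := trilinear_swap23 Tsym.

(** Along a line in a transversal direction the cubic has generically three
    distinct roots, at which the quartic vanishes.  The quotient is read off the
    two leading coefficients. *)
Lemma quartic_multiple_of_cubic (P : {mpoly algC[4]}) : (msize P <= 5)%N ->
  (forall x, t x x x = 0 -> P.@[x] = 0) ->
  exists2 L, polyfun L & forall x, P.@[x] = L x * t x x x.
Proof.
move=> sP P0; have [q q0 tqqq] := cubic_zero_exists Tsym.
have [d [ddd qqd disc]] := transversal_direction_exists Tsym Tsmooth q0 tqqq.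
pose p y := line_poly P y d.
have p5 y : (size (p y) <= 5)%N := leq_trans (size_line_poly P y d) sP.
have pE y s : (p y).[s] = (p y)`_0 + (p y)`_1 * s + (p y)`_2 * s ^+ 2
    + (p y)`_3 * s ^+ 3 + (p y)`_4 * s ^+ 4.
  by rewrite (horner_coef_wide s (p5 y)) !big_ord_recr big_ord0 /=; ring.
have Pval s : polyfun (fun y => (p y).[s]).
  apply: (eq_polyfun (phi := fun y => P.@[fun i => lincomb 1 y s d i])).
    by move=> y; rewrite horner_line_poly.
  apply: polyfun_meval => i; apply: polyfunD; last exact: polyfunC.
  by apply: polyfunM; [exact: polyfunC | exact: polyfun_coord].
have N2 : (24%:R : algC) != 0 by rewrite pnatr_eq0.
(* The coefficients of a quartic are combinations of five of its values. *)
have P4 : polyfun (fun y => (p y)`_4).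
  apply: (eq_polyfun (phi := fun y => 24%:R^-1 * ((p y).[2%:R]
    - 4%:R * (p y).[1] + 6%:R * (p y).[0] - 4%:R * (p y).[-1] + (p
      y).[-2%:R]))).
    by move=> y; rewrite !pE; field.
  by repeat (apply: polyfunD || apply: polyfunN || apply: polyfunC
    || apply: polyfunM || apply: Pval).
have P3 : polyfun (fun y => (p y)`_3).
  apply: (eq_polyfun (phi := fun y => 12%:R^-1 * ((p y).[2%:R]
    - 2%:R * (p y).[1] + 2%:R * (p y).[-1] - (p y).[-2%:R]))).
    by move=> y; rewrite !pE; field.
  by repeat (apply: polyfunD || apply: polyfunN || apply: polyfunC
    || apply: polyfunM || apply: Pval).
pose a := t d d d; pose b y := 3%:R * t d d y.
pose c y := 3%:R * t d y y; pose e y := t y y y.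
have Pb : polyfun b.
  apply: polyfunM; first exact: polyfunC.
  exact: (polyfun_diag T false false true d d d).
have Pc : polyfun c.
  apply: polyfunM; first exact: polyfunC.
  exact: (polyfun_diag T false true true d d d).
have Pe : polyfun e by exact: (polyfun_diag T true true true d d d).
pose l1 y := (p y)`_4 / a.
pose l0 y := ((p y)`_3 - l1 y * b y) / a.
have Pl1 : polyfun l1 by apply: polyfunM => //; apply: polyfunC.
have Pl0 : polyfun l0.
  apply: polyfunM; last exact: polyfunC.
  by apply: polyfunD => //; apply: polyfunN; apply: polyfunM.
exists l0 => // y; apply/eqP; rewrite -subr_eq0; apply/eqP; move: y.
pose D y := b y ^+ 2 * c y ^+ 2 - 4%:R * a * c y ^+ 3 - 4%:R * b y ^+ 3 * e y
    - 27%:R * a ^+ 2 * e y ^+ 2 + 18%:R * a * b y * c y * e y.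
have PD : polyfun D.
  by repeat (exact: Pb || exact: Pc || exact: Pe || apply: polyfunC
    || apply: polyfunX || apply: polyfunN || apply: polyfunD
    || apply: polyfunM).
have Dq : D q != 0.
  have -> : D q = 27%:R * t q q d ^+ 2 *
      (3%:R * t q d d ^+ 2 - 4%:R * t d d d * t q q d).
    rewrite /D /a /b /c /e tqqq (t12 d q q) (t23 q d q) (t23 d d q) (t12 d q d).
    by ring.
  by rewrite !mulf_neq0 // ?sqrf_eq0 ?pnatr_eq0.
apply: (polyfun_mul_eq0 _ PD _ Dq).
  apply: polyfunD; last by apply/polyfunN/polyfunM.
  by exists P.
move=> y; have [->|Dy] := eqVneq (D y) 0; first by rewrite mulr0.
have [rs [rsU rs3 rsP]] := cubic_distinct_roots ddd Dy.
have p40 : (p y)`_4 = l1 y * a by rewrite divfK.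
have p30 : (p y)`_3 = l1 y * b y + l0 y * a by rewrite divfK // addrC subrK.
have [||_ _ E] := @quadratic_eq0 ((p y)`_2 - l1 y * c y - l0 y * b y)
  ((p y)`_1 - l1 y * e y - l0 y * c y) ((p y)`_0 - l0 y * e y) rs rsU.
- by rewrite rs3.
- move=> r /rsP gr0.
  have pr0 : (p y).[r] = 0.
    rewrite horner_line_poly P0 // -[RHS]gr0 !lin.
    rewrite (t12 y d d) (t23 d y d) (t23 y y d) (t12 y d y).
    rewrite /a /b /c /e.
    by ring.
  transitivity ((p y).[r] - (l1 y * r + l0 y) *
    (a * r ^+ 3 + b y * r ^+ 2 + c y * r + e y)).
    by rewrite pE p40 p30; ring.
  by rewrite pr0 gr0 mulr0 subr0.
have <- : (p y)`_0 = P.@[y].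
  rewrite -horner_coef0 horner_line_poly; apply: meval_eq => i.
  by rewrite /lincomb mul0r addr0 mul1r.
by rewrite -/(e y) E mul0r.
Qed.

(** Comparing homogeneous components makes the quotient a linear form. *)
Lemma quartic_linear_multiple (P c : {mpoly algC[4]}) :
  P \is 4.-homog -> c \is 3.-homog -> (forall x, c.@[x] = t x x x) ->
  (forall x, c.@[x] = 0 -> P.@[x] = 0) ->
  exists l : 'I_4 -> algC, forall x, P.@[x] = (\sum_i l i * x i) * c.@[x].
Proof.
move=> P4 c3 cE P0.
have [||l [L EL] PE] := @quartic_multiple_of_cubic P.
- rewrite msizeE; apply/bigmax_leqP_seq => m mP _.
  by rewrite (dhomog_mf P4 mP).
- by move=> x; rewrite -cE; apply: P0.
have {}PE : P = L * c.
  by apply: meval_inj_alg => x; rewrite mevalM cE PE EL.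
pose L1 := pihomog mdeg 1 L.
have PE1 : P = L1 * c.
  have sL : (msize L <= (msize L).+2)%N by do 2!apply: leqW.
  rewrite -(pihomog_dE P4) {1}PE {1}(pihomog_partitionE sL) big_distrl /=.
  rewrite raddf_sum (bigD1 (inord 1)) //= inordK // big1 => [|d d1].
    by rewrite addr0 pihomog_dE // (dhomogM (pihomogP _ 1 L) c3).
  apply: (pihomog_ne0 _ (dhomogM (pihomogP _ d L) c3)).
  apply: contraNneq d1 => d4; rewrite -val_eqE /= inordK //.
  by rewrite -(eqn_add2r 3) d4.
have L1H : L1 \is 1.-homog by apply: pihomogP.
exists (fun i => (L1^`M(i)).@[fun=> 0]) => x; rewrite PE1 mevalM.
congr (_ * _); rewrite -[LHS]mul1r -(euler_identity x L1H).
apply: eq_bigr => i _; rewrite mulrC; congr (_ * _).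
by apply: meval_dhomog0; apply: dhomog_mderiv.
Qed.


End QuarticQuotient.

(** * Reduction modulo the equation of the triple cover *)

Lemma meval_mwiden (R : comNzRingType) n (P : {mpoly R[n]}) (v : 'I_n.+1 -> R) :
  (mwiden P).@[v] = P.@[fun i => v (widen_ord (leqnSn n) i)].
Proof.
rewrite /mwiden /mmap raddf_sum [RHS]mevalE; apply: eq_bigr => m _ /=.
rewrite mevalM mevalC /mmap1 rmorph_prod; congr (_ * _); apply: eq_bigr => i _.
by rewrite /= rmorphXn /= mevalXU.
Qed.

Lemma triple_cover_eq0 (R : fieldType) (f : {mpoly R[5]}) (v : 'I_6 -> R) :
  (triple_cover f).@[v] = 0 <->
  v ord_max ^+ 3 = f.@[fun i => v (widen_ord (leqnSn 5) i)].
Proof.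
rewrite mevalB rmorphXn /= mevalXU meval_mwiden.
by split => [/eqP|->]; rewrite ?subrr // subr_eq0 => /eqP.
Qed.

Definition cover_point (x : 'I_5 -> algC) (y : algC) : 'I_6 -> algC :=
  fun i => if unlift ord_max i is Some j then x j else y.

Lemma cover_point_max x y : cover_point x y ord_max = y.
Proof. by rewrite /cover_point unlift_none. Qed.

Lemma cover_point_widen x y i :
  cover_point x y (widen_ord (leqnSn 5) i) = x i.
Proof.
rewrite /cover_point (_ : widen_ord _ i = lift ord_max i) ?liftK //.
by apply: val_inj; rewrite /= /bump leqNgt ltn_ord.
Qed.

(** Division by the equation [y ^ 3 = f]. *)
Lemma cover_reduction (f : {mpoly algC[5]}) (g : {mpoly algC[6]}) :
  exists G0 G1 G2 : {mpoly algC[5]}, forall x y, y ^+ 3 = f.@[x] ->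
    g.@[cover_point x y] = G2.@[x] * y ^+ 2 + G1.@[x] * y + G0.@[x].
Proof.
elim/mpolyind: g => [|c m g _ _ [G0 [G1 [G2 IHg]]]].
  by exists 0, 0, 0 => x y _; rewrite !meval0 !mul0r !addr0.
pose M : {mpoly algC[5]} :=
  c *: (\prod_(i < 5) 'X_i ^+ m (widen_ord (leqnSn 5) i)) * f ^+ (m ord_max %/
    3).
pose k := (m ord_max %% 3)%N.
exists (G0 + (k == 0)%:R * M), (G1 + (k == 1)%:R * M), (G2 + (k == 2)%:R * M).
move=> x y yf; rewrite !mevalD (IHg x y yf) mevalZ mevalX big_ord_recr /=.
rewrite cover_point_max.
have -> : y ^+ m ord_max = f.@[x] ^+ (m ord_max %/ 3) * y ^+ k.
  by rewrite {1}(divn_eq (m ord_max) 3) exprD mulnC exprM yf.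
have : M.@[x] = c * (\prod_(i < 5) x i ^+ m (widen_ord (leqnSn 5) i)) *
    f.@[x] ^+ (m ord_max %/ 3).
  rewrite /M mevalM mevalZ rmorph_prod rmorphXn /=; congr (_ * _ * _).
  by apply: eq_bigr => i _; rewrite rmorphXn /= mevalXU.
under [X in c * (X * _)]eq_bigr => i _ do rewrite cover_point_widen.
move=> ME; clearbody M; rewrite !mevalM ME.
move: (\prod_(i < 5) _) (f.@[x] ^+ _) => u1 u2.
have : (k < 3)%N by rewrite ltn_mod.
case: k => [|[|[|//]]] _; rewrite /= ?mevalC ?meval0 ?meval1 ?(rmorph0,
  rmorph1); ring.
Qed.

(** * The tangent process over polynomials and over subfields *)

Lemma tangent_orbit_polyfun n (A B C : ('I_n -> algC) -> algC) k :
  polyfun A -> polyfun B -> polyfun C ->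
  [/\ polyfun (fun v => (tangent_orbit (A v) (B v) (C v) k).1.1),
      polyfun (fun v => (tangent_orbit (A v) (B v) (C v) k).1.2) &
      polyfun (fun v => (tangent_orbit (A v) (B v) (C v) k).2)].
Proof.
move=> PA PB PC.
elim: k => [|k].
  by split; repeat (exact: PA || exact: PB || exact: PC || apply: polyfunC
    || apply: polyfunX || apply: polyfunN || apply: polyfunD
    || apply: polyfunM).
pose O v := tangent_orbit (A v) (B v) (C v) k.
rewrite -/(O _) => -[PU PV PW].
pose U v := (O v).1.1; pose V v := (O v).1.2; pose W v := (O v).2.
have stepE v : tangent_orbit (A v) (B v) (C v) k.+1 =
    tangent_step (A v) (B v) (C v) (U v, V v, W v).
  by rewrite /U /V /W -!surjective_pairing.
pose g v := binary_cubic (A v) (B v) (C v) (U v) (V v).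
pose g1 v := 3%:R * U v ^+ 2 + 2%:R * A v * U v * V v + B v * V v ^+ 2.
pose g2 v := 6%:R * U v + 2%:R * A v * V v.
have Pg : polyfun g.
  by repeat (exact: PA || exact: PB || exact: PC || exact: PU || exact: PV
    || apply: polyfunC || apply: polyfunX || apply: polyfunD
    || apply: polyfunM).
have Pg1 : polyfun g1.
  by repeat (exact: PA || exact: PB || exact: PC || exact: PU || exact: PV
    || apply: polyfunC || apply: polyfunX || apply: polyfunD
    || apply: polyfunM).
have Pg2 : polyfun g2.
  by repeat (exact: PA || exact: PU || exact: PV
    || apply: polyfunC || apply: polyfunD || apply: polyfunM).
pose D v := 2%:R * (27%:R * g v ^+ 2 - g1 v ^+ 3).
pose N v := 18%:R * g v * g1 v ^+ 2 - 27%:R * g v ^+ 2 * g2 v.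
pose Q v := 54%:R * g v ^+ 2 + 4%:R * g1 v ^+ 3 - 9%:R * g v * g1 v * g2 v.
have [PD PN PQ] : [/\ polyfun D, polyfun N & polyfun Q].
  by split; repeat (exact: Pg || exact: Pg1 || exact: Pg2 || apply: polyfunC
    || apply: polyfunX || apply: polyfunN || apply: polyfunD
    || apply: polyfunM).
split.
- apply: (eq_polyfun (phi := fun v => U v * D v + N v)).
    by move=> v; rewrite stepE.
  by apply: polyfunD => //; apply: polyfunM.
- apply: (eq_polyfun (phi := fun v => V v * D v)); last exact: polyfunM.
  by move=> v; rewrite stepE.
- apply: (eq_polyfun (phi := fun v => W v * Q v)); last exact: polyfunM.
  by move=> v; rewrite stepE.
Qed.

Lemma tangent_orbit_subfield (K : algC -> Prop) (A B C : algC) k :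
  subfield_pred K -> K A -> K B -> K C ->
  [/\ K (tangent_orbit A B C k).1.1, K (tangent_orbit A B C k).1.2 &
      K (tangent_orbit A B C k).2].
Proof.
move=> KF KA KB KC.
have Kn := subfield_nat KF; have KX := subfieldX KF.
have KM x y : K x -> K y -> K (x * y) by apply: subfieldM.
have KB' x y : K x -> K y -> K (x - y) by apply: subfieldB.
have KD x y : K x -> K y -> K (x + y) by apply: subfieldD.
elim: k => [|k].
  by rewrite /tangent_orbit /tangent_start /=; split; repeat (assumption ||
    apply: (Kn)
  || apply: (KX) || apply: (KB') || apply: (KD) || apply: (KM)).
have -> : tangent_orbit A B C k.+1 =
  tangent_step A B C (tangent_orbit A B C k) by [].
case: (tangent_orbit A B C k) => [[U V] W] [/= KU KV KW].
have Kg : K (binary_cubic A B C U V).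
  by repeat (assumption || apply: (Kn) || apply: (KX) || apply: (KD) || apply:
    (KM)).
rewrite /tangent_step /=; move: (binary_cubic _ _ _ _ _) Kg => g Kg.
by split; repeat (assumption || apply: (Kn) || apply: (KX) || apply: (KB')
  || apply: (KD) || apply: (KM)).
Qed.

(** * Density of rational points on the cover *)

(** The points [r p + z] of projective space, [z] in the coordinate hyperplane
    number [i]: when [p i = 1], the lines [z = constant] are the lines through
    [p]. *)
Definition chart_vec (i : 'I_5) (z : 'I_4 -> algC) : 'I_5 -> algC :=
  fun j => if unlift i j is Some k then z k else 0.

Lemma chart_vec_lift i z k : chart_vec i z (lift i k) = z k.
Proof. by rewrite /chart_vec liftK. Qed.

Lemma chart_vec_self i z : chart_vec i z i = 0.
Proof. by rewrite /chart_vec unlift_none. Qed.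

Lemma chart_point_exists i p x : p i = 1 ->
  exists z, x = lincomb 1 (chart_vec i z) (x i) p.
Proof.
move=> pi1; exists (fun k => x (lift i k) - x i * p (lift i k)).
apply: functional_extensionality => j; rewrite /lincomb mul1r.
have [k ->|->] := unliftP i j; first by rewrite chart_vec_lift subrK.
by rewrite chart_vec_self add0r pi1 mulr1.
Qed.

Section DensityOnCover.

Variables (f : {mpoly algC[5]}) (i : 'I_5) (p : 'I_5 -> algC).
Hypothesis pi1 : p i = 1.

Variables c3 c4 c5 c6 : {mpoly algC[4]}.
Hypothesis fE : forall r z, f.@[lincomb 1 (chart_vec i z) r p] =
  r ^+ 3 * c3.@[z] + r ^+ 2 * c4.@[z] + r * c5.@[z] + c6.@[z].

Variable T : 'I_4 -> 'I_4 -> 'I_4 -> algC.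
Hypothesis Tsym : symmetric_tensor T.
Hypothesis Tsmooth : forall x : 'I_4 -> algC, nonzero_vec x ->
  exists k, trilinear T x x (unit_vec k) != 0.
Hypothesis c3E : forall z, c3.@[z] = trilinear T z z z.

Let A z := c4.@[z].
Let B z := c3.@[z] * c5.@[z].
Let C z := c3.@[z] ^+ 2 * c6.@[z].
Let U k z := (tangent_orbit (A z) (B z) (C z) k).1.1.
Let V k z := (tangent_orbit (A z) (B z) (C z) k).1.2.
Let W k z := (tangent_orbit (A z) (B z) (C z) k).2.

Let orbit_polyfun k : [/\ polyfun (U k), polyfun (V k) & polyfun (W k)].
Proof.
have Pc (c : {mpoly algC[4]}) : polyfun (fun z => c.@[z]) by exists c.
apply: tangent_orbit_polyfun; first exact: Pc.
  by apply: polyfunM; apply: Pc.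
by apply: polyfunM; [apply: polyfunX|]; apply: Pc.
Qed.

(** Where the cubic term of the equation vanishes and the quartic term does
    not, the plane cubic is cuspidal, so the tangent process produces infinitely
    many points there, and hence on the generic fibre. *)
Lemma generic_orbit_points (x0 : 'I_4 -> algC) N :
  c3.@[x0] = 0 -> c4.@[x0] != 0 ->
  exists2 D, polyfun D & (exists z, D z != 0) /\ forall z, D z != 0 ->
    [/\ c3.@[z] != 0, forall k, (k < N)%N -> V k z != 0 /\ W k z != 0 &
       forall k l, (k < N)%N -> (l < N)%N -> k != l ->
         U k z * V l z != U l z * V k z].
Proof.
move=> c30 c40.
pose D1 z := \prod_(k < N) (V k z * W k z).
pose D2 z := \prod_(k < N) \prod_(l < N | k != l) (U k z * V l z - U l z * V k
  z).
have PU k : polyfun (U k) by have [] := orbit_polyfun k.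
have PV k : polyfun (V k) by have [] := orbit_polyfun k.
have PW k : polyfun (W k) by have [] := orbit_polyfun k.
have PD1 : polyfun D1.
  by apply: (polyfun_prod _ _ (phi := fun (k : 'I_N) z => V k z * W k z)) => k;
    apply: polyfunM.
have PD2 : polyfun D2.
  apply: (polyfun_prod _ _ (phi := fun (k : 'I_N) z =>
    \prod_(l < N | k != l) (U k z * V l z - U l z * V k z))) => k.
  apply: (polyfun_prod _ _ (phi := fun (l : 'I_N) z =>
    U k z * V l z - U l z * V k z)) => l.
  by apply: polyfunD; [|apply: polyfunN]; apply: polyfunM.
have Pc3 : polyfun (fun z => c3.@[z]) by exists c3.
exists (fun z => c3.@[z] * (D1 z * D2 z)).
  by apply: polyfunM => //; apply: polyfunM.
split.
  apply: polyfun_mul_neq0 => //; first exact: polyfunM.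
    have [z] := @cubic_value_neq0 T Tsym Tsmooth (fun=> 1) (ex_intro _ ord0
      (oner_neq0 _)).
    by rewrite -c3E; exists z.
  exists x0.
  pose u k : algC := (-2%:R) ^+ k.+1.
  have orb k : exists2 kap : algC, kap != 0 & [/\ U k x0 = kap * A x0,
      V k x0 = kap * (u k ^+ 3 - 1) & W k x0 = kap * (u k * A x0)].
    have [kap k0 E] := tangent_orbit_cusp k c40.
    exists kap => //; rewrite /U /V /W.
    have -> : B x0 = 0 by rewrite /B c30 mul0r.
    have -> : C x0 = 0 by rewrite /C c30 expr0n mul0r.
    by rewrite E.
  have A0 : A x0 != 0 := c40.
  have normu k : `|u k| = (2 ^ k.+1)%:R.
    by rewrite normrX normrN normr_nat natrX.
  have u1 k : u k ^+ 3 - 1 != 0.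
    rewrite subr_eq0; apply: contraTneq isT => /(congr1 (fun x => `|x|)).
    rewrite normrX normu normr1 -natrX => /eqP.
    by rewrite pnatr_eq1 -expnM gtn_eqF // -(expn0 2) ltn_exp2l.
  have u0 k : u k != 0 by rewrite expf_neq0 // oppr_eq0 pnatr_eq0.
  clearbody u; rewrite mulf_neq0 //; apply/prodf_neq0 => k _.
    have [kap k0 [_ -> ->]] := orb k.
    by rewrite !mulf_neq0.
  apply/prodf_neq0 => l kl.
  have [ka ka0 [-> -> _]] := orb k; have [la la0 [-> -> _]] := orb l.
  rewrite (_ : _ - _ = ka * la * A x0 * (u l ^+ 3 - u k ^+ 3)); last by ring.
  rewrite !mulf_neq0 // subr_eq0; apply: contraNneq kl.
  move=> /(congr1 (fun x => `|x|)); rewrite !normrX !normu -!natrX => /eqP.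
  by rewrite eqr_nat -!expnM eqn_exp2l // eqn_pmul2r // eqSS eq_sym.
move=> z; rewrite !mulf_eq0 !negb_or => /and3P[c3z D1z D2z]; split=> //.
  move=> k kN; move/prodf_neq0: D1z => /(_ (Ordinal kN) isT).
  by rewrite mulf_eq0 negb_or => /andP.
move=> k l kN lN kl; move/prodf_neq0: D2z => /(_ (Ordinal kN) isT).
by move=> /prodf_neq0/(_ (Ordinal lN) kl); rewrite subr_eq0.
Qed.

Section RationalPoints.

Variable K : algC -> Prop.
Hypothesis KF : subfield_pred K.
Hypothesis Kp : forall j, K (p j).
Hypothesis Kc : forall z, (forall k, K (z k)) ->
  [/\ K c3.@[z], K c4.@[z], K c5.@[z] & K c6.@[z]].
Hypothesis KT : forall x y z, (forall k, K (x k)) -> (forall k, K (y k)) ->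
  (forall k, K (z k)) -> K (trilinear T x y z).
Variable e : algC.
Hypotheses (Ke : K e) (e3 : 3.-primitive_root e).

(** If the cubic term takes a non-zero cube at [z], the plane cubic over [z] is
    isomorphic to [Y ^ 3 = T ^ 3 + A T ^ 2 + B T + C], and the tangent process
    gives rational points on it. *)
Lemma orbit_point_on_cover z w k : (forall j, K (z j)) -> K w ->
  c3.@[z] = w ^+ 3 -> c3.@[z] != 0 -> V k z != 0 -> W k z != 0 ->
  let r := U k z / (V k z * c3.@[z]) in
  exists y, [/\ K r, K y, y != 0 & y ^+ 3 = f.@[lincomb 1 (chart_vec i z) r p]].
Proof.
move=> Kz Kw c3w c30 V0 W0 r.
have [K3 K4 K5 K6] := Kc Kz.
have KB' : K (B z) by apply: subfieldM.
have KC' : K (C z) by apply: subfieldM => //; apply: subfieldX.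
have [KU KV KW] := tangent_orbit_subfield k KF K4 KB' KC'.
have w0 : w != 0 by apply: contraNneq c30 => w0; rewrite c3w w0 expr0n.
exists (W k z / (V k z * w ^+ 2)); split.
- by apply: subfieldM => //; apply: subfieldV => //; apply: subfieldM.
- apply: subfieldM => //; apply: subfieldV => //; apply: subfieldM => //.
  exact: subfieldX.
- by rewrite mulf_neq0 // invr_eq0 mulf_neq0 // expf_neq0.
rewrite fE /r {r} expr_div_n (_ : W k z ^+ 3 = binary_cubic (A z) (B z) (C z)
  (U k z) (V k z)); last exact: tangent_orbit_on_cubic.
rewrite /binary_cubic /A /B /C c3w.
by move: (U k z) (V k z) V0 => u v v0; field; rewrite v0 w0.
Qed.

Variables (q v : 'I_4 -> algC) (w0 : algC).
Hypotheses (Kq : forall j, K (q j)) (Kv : forall j, K (v j)) (Kw0 : K w0).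
Hypotheses (q0 : nonzero_vec q) (lineN0 : forall s, nonzero_vec (lincomb s q 1
  v)).
Hypotheses (tqqq : trilinear T q q q = 0) (tqqv : trilinear T q q v = 0).
Hypotheses (tqvv : trilinear T q v v = 0) (tvvv : trilinear T v v v = w0 ^+ 3).

Variable x0 : 'I_4 -> algC.
Hypotheses (c30 : c3.@[x0] = 0) (c40 : c4.@[x0] != 0).

(** A polynomial of degree at most two in [y] that vanishes at [y], [e y] and
    [e ^ 2 y] has zero coefficients.  For generic rational [z] this happens at
    more points of the line over [z] than the degree of the coefficients allows,
    so the coefficients vanish on that line; and such [z] are dense. *)
Lemma rational_points_dense_on_cover (g : {mpoly algC[6]}) :
  (forall x y, (forall j, K (x j)) -> K y -> y != 0 -> y ^+ 3 = f.@[x] ->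
     g.@[cover_point x y] = 0) ->
  forall x y, y ^+ 3 = f.@[x] -> g.@[cover_point x y] = 0.
Proof.
move=> gK; have [G0 [G1 [G2 gE]]] := cover_reduction f g.
pose N := (maxn (msize G0) (maxn (msize G1) (msize G2))).+1.
have [D PD [[zD zD0] DP]] := generic_orbit_points N c30 c40.
have dense (G : {mpoly algC[5]}) : (msize G < N)%N ->
    (forall x y, (forall j, K (x j)) -> K y -> y != 0 -> y ^+ 3 = f.@[x] ->
       G.@[x] = 0) ->
    forall x, G.@[x] = 0.
  move=> sG GK x; have [z ->] := chart_point_exists x pi1.
  move: (x i) => r; move: z.
  have PG : polyfun (fun z => G.@[lincomb 1 (chart_vec i z) r p]).
    apply: (polyfun_meval G (phi := fun j z => lincomb 1 (chart_vec i z) r p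
      j)).
    move=> j; apply: polyfunD; last exact: polyfunC.
    apply: polyfunM; first exact: polyfunC.
    by rewrite /chart_vec; case: (unlift i j) => [k|];
      [exact: polyfun_coord | exact: polyfunC].
  apply: (polyfun_mul_eq0 PG PD _ zD0).
  apply: (cube_values_dense Tsym Tsmooth tqqq tqqv tqvv tvvv KF KT Kq Kv Kw0 q0
    lineN0 (polyfunM PG PD)) => z w Kz Kw zw.
  have [->|Dz] := eqVneq (D z) 0; first by rewrite mulr0.
  have [c3z VW UV] := DP z Dz; rewrite -horner_line_poly.
  suff -> : line_poly G (chart_vec i z) p = 0 by rewrite horner0 mul0r.
  pose rs := [seq U k z / (V k z * c3.@[z]) | k <- iota 0 N].
  apply/eqP; apply: contraT => LN0.
  suff : (size rs < N)%N by rewrite size_map size_iota ltnn.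
  apply: leq_trans (max_poly_roots LN0 _ _) _.
  - apply/allP => s /mapP[k]; rewrite mem_iota add0n => /= kN ->.
    have [Vk Wk] := VW k kN; rewrite -c3E in zw.
    have [y [Kr Ky y0 yE]] := orbit_point_on_cover Kz Kw zw c3z Vk Wk.
    rewrite /root horner_line_poly (GK _ y) // => j.
    apply: subfieldD => //; apply: subfieldM => //; first exact: subfield1.
    by rewrite /chart_vec; case: (unlift i j) => [l|]; [exact: Kz | exact:
      subfield0].
  - rewrite map_inj_in_uniq ?iota_uniq // => k l; rewrite !mem_iota !add0n /=.
    move=> kN lN E; apply/eqP; apply: contraT => kl.
    have [Vk _] := VW k kN; have [Vl _] := VW l lN.
    case/eqP: (UV k l kN lN kl); apply: (mulIf c3z).
    transitivity (U k z / (V k z * c3.@[z]) * (V k z * V l z * c3.@[z] ^+ 2)).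
      by field; rewrite Vk c3z.
    by rewrite E; field; rewrite Vl c3z.
  - exact: leq_trans (size_line_poly _ _ _) (ltnW sG).
have e1 : e != 1.
  by apply/negP; have := eq_prim_root_expr e3 1 0; rewrite expr1 expr0 => ->.
have GK x y : (forall j, K (x j)) -> K y -> y != 0 -> y ^+ 3 = f.@[x] ->
    [/\ G2.@[x] = 0, G1.@[x] = 0 & G0.@[x] = 0].
  move=> Kx Ky y0 yf; have ee : e ^+ 3 = 1 := prim_expr_order e3.
  have e0 : e != 0 by apply: contraTneq isT => E; move: ee; rewrite E expr0n =>
    /eqP; rewrite eq_sym oner_eq0.
  apply: (@quadratic_eq0 _ _ _ [:: y; e * y; e ^+ 2 * y]) => //.
    have ne k l : (e ^+ k * y == e ^+ l * y) = (k == l %[mod 3]).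
      by rewrite (inj_eq (mulIf y0)) (eq_prim_root_expr e3).
    have := (ne 0 1, ne 0 2, ne 1 2)%N; rewrite expr0 expr1 mul1r => -[[n1 n2]
      n3].
    by rewrite /= !inE negb_or n1 n2 n3.
  move=> r; rewrite !inE => /or3P[] /eqP ->.
  - by rewrite -gE // gK.
  - by rewrite -gE ?gK ?exprMn ?ee ?mul1r ?mulf_neq0 //; apply: subfieldM.
  - rewrite -gE ?gK ?exprMn -?exprM ?(exprM e 3 2) ?ee ?expr1n ?mul1r
    ?mulf_neq0 ?expf_neq0 //; apply: subfieldM => //; exact: subfieldX.
move=> x y yf; rewrite gE //.
have sG2 : (msize G2 < N)%N by rewrite ltnS !leq_max leqnn !orbT.
have sG1 : (msize G1 < N)%N by rewrite ltnS !leq_max leqnn !orbT.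
have sG0 : (msize G0 < N)%N by rewrite ltnS !leq_max leqnn.
rewrite (dense G2) // => [|a b Ka Kb b0 ab]; last by have [] := GK a b.
rewrite (dense G1) // => [|a b Ka Kb b0 ab]; last by have [] := GK a b.
rewrite (dense G0) // => [|a b Ka Kb b0 ab]; last by have [] := GK a b.
by rewrite !mul0r !addr0.
Qed.

End RationalPoints.

End DensityOnCover.

(** * The equation near a triple point *)

Lemma meval_dhomog_scale n d (P : {mpoly algC[n]}) a x : P \is d.-homog ->
  P.@[fun i => a * x i] = a ^+ d * P.@[x].
Proof.
move=> PH; rewrite !mevalE big_distrr /= big_seq [RHS]big_seq.
apply: eq_bigr => m /(dhomog_mf PH) /= <-; rewrite mulrCA; congr (_ * _).
rewrite mdegE -prodrXr -big_split; apply: eq_bigr => i _ /=.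
by rewrite exprMn.
Qed.


Section TriplePoint.

Variables (f : {mpoly algC[5]}) (p : 'I_5 -> algC) (i : 'I_5).
Hypotheses (fH : f \is 6.-homog) (pi0 : p i != 0).
Hypothesis f3 : multiplicity_at_origin (local_equation f p i) 3.

Let ph j := p j / p i.
Let h := local_equation f p i.
Let c k := pihomog mdeg k h.

Lemma meval_local_equation z :
  h.@[z] = f.@[lincomb 1 (chart_vec i z) 1 ph].
Proof.
rewrite /h /local_equation comp_mpoly_meval; apply: meval_eq => j.
rewrite tnth_mktuple /lincomb /chart_vec !mul1r.
case: unliftP => [k ->|->]; first by rewrite mevalD mevalC mevalXU addrC.
by rewrite meval1 add0r /ph divff.
Qed.

(** Homogenising: the component of degree [k] of the local equation is the
    coefficient of [r ^ (6 - k)] in the equation on the line through [p] and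
    [z]. *)
Lemma triple_point_expansion r z :
  f.@[lincomb 1 (chart_vec i z) r ph] =
  r ^+ 3 * (c 3).@[z] + r ^+ 2 * (c 4).@[z] + r * (c 5).@[z] + (c 6).@[z].
Proof.
pose L := line_poly f (chart_vec i z) ph; pose N := (msize h + 7)%N.
have sL : (size L <= 7)%N.
  apply: leq_trans (size_line_poly _ _ _) _.
  rewrite msizeE; apply/bigmax_leqP_seq => m mf _.
  by rewrite (dhomog_mf fH mf).
have LE s : L.[s] = f.@[lincomb 1 (chart_vec i z) s ph].
  exact: horner_line_poly.
clearbody L.
(* The factor ['X^N] keeps the exponents of [r] non-negative in the homogenised
   local equation, whose degree is not bounded a priori. *)
have E : 'X^N * L = \sum_(k < N) (c k).@[z] *: 'X^(6 + N - k).
  apply/eqP; rewrite -subr_eq0; apply/eqP/poly_eq0_nat => -[|n].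
    have N0 : (N == 0)%N = false by rewrite addn_eq0 andbF.
    rewrite hornerD hornerN hornerM hornerXn horner_sum expr0n N0 mul0r.
    rewrite big1 ?subrr // => k _; rewrite hornerZ hornerXn expr0n.
    by rewrite subn_eq0 leqNgt ltn_addl ?ltn_ord // mulr0.
  set s : algC := n.+1%:R.
  have s0 : s != 0 by rewrite pnatr_eq0.
  clearbody s.
  rewrite hornerD hornerN hornerM hornerXn horner_sum LE.
  have -> : lincomb 1 (chart_vec i z) s ph =
      fun j => s * lincomb 1 (chart_vec i (fun k => s^-1 * z k)) 1 ph j.
    apply: functional_extensionality => j; rewrite /lincomb /chart_vec.
    by case: (unlift i j) => [k|]; field.
  rewrite (meval_dhomog_scale _ _ fH) -meval_local_equation.
  rewrite {1}(pihomog_partitionE (leq_addr 7 (msize h))) raddf_sum /=.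
  rewrite mulrA -exprD big_distrr -sumrB big1 // => k _ /=.
  rewrite (meval_dhomog_scale _ _ (pihomogP _ k h)) hornerZ hornerXn.
  have kN : (k <= 6 + N)%N by rewrite ltnW // ltn_addl.
  have sk : s ^+ (6 + N) * s^-1 ^+ k = s ^+ (6 + N - k).
    by rewrite -{1}(subnK kN) exprD exprVn mulfK ?expf_neq0.
  by rewrite mulrA (addnC N) sk mulrC subrr.
have Lj j : (j < 7)%N -> L`_j = (c (6 - j)).@[z].
  move=> j7; have := congr1 (fun q : {poly algC} => q`_(N + j)) E.
  rewrite coefXnM ltnNge leq_addr /= addKn => ->.
  have jN : (6 - j < N)%N by rewrite ltn_addl // ltnS leq_subr.
  rewrite coef_sum (bigD1 (Ordinal jN)) //= big1 => [|k].
    rewrite coefZ coefXn addr0 (_ : N + j == 6 + N - (6 - j))%N ?mulr1 //.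
    by lia.
  rewrite -val_eqE /= coefZ coefXn => kj; rewrite (_ : (_ == _) = false) ?mulr0
    //.
  by have := ltn_ord k; lia.
rewrite -LE (horner_coef_wide r sL) !big_ord_recr big_ord0 /=.
have c0 k : (k < 3)%N -> (c k).@[z] = 0 by move=> /f3.1 E0; rewrite /c E0
  meval0.
by rewrite !Lj //= (c0 2) // (c0 1) // (c0 0) //; ring.
Qed.

End TriplePoint.

(** * Number fields *)

Lemma meval_map_mpoly (R S : comNzRingType) (phi : {rmorphism R -> S}) n
    (P : {mpoly R[n]}) (v : 'I_n -> R) :
  (map_mpoly phi P).@[fun i => phi (v i)] = phi P.@[v].
Proof.
rewrite /map_mpoly /mmap raddf_sum [P.@[v]]mevalE rmorph_sum.
apply: eq_bigr => m _ /=; rewrite mevalM mevalC rmorphM; congr (_ * _).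
rewrite /mmap1 !rmorph_prod; apply: eq_bigr => i _ /=.
by rewrite !rmorphXn /= mevalXU.
Qed.

Lemma dhomog_map_mpoly (R S : fieldType) (phi : {rmorphism R -> S}) n d
    (P : {mpoly R[n]}) : P \is d.-homog -> map_mpoly phi P \is d.-homog.
Proof.
move=> PH; apply/dhomogP => m; rewrite mcoeff_msupp mcoeff_map_mpoly.
by rewrite fmorph_eq0 -mcoeff_msupp => /(dhomog_mf PH).
Qed.

(** A primitive element of the given numbers over the rationals generates over
    [F] an extension that contains them all. *)
Lemma number_field_containing (F : fieldExtType rat)
    (iota : {rmorphism F -> algC}) (s : seq algC) :
  exists (K : fieldExtType F) (j : {rmorphism K -> algC}),
    (forall a : F, j a%:A = iota a) /\ (forall x, x \in s -> exists a, x = j a).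
Proof.
have ratE : iota \o in_alg F =1 ratr by exact: fmorph_eq_rat.
have [z _ [ps sE]] := algC_PET s.
have [r [_ r0] rz] := minCpolyP z.
have [p [p0 pz pmin]] : exists p : {poly F}, [/\ p != 0,
    root (map_poly iota p) z &
    forall q, root (map_poly iota q) z -> q != 0 -> (size p <= size q)%N].
  have : exists p : {poly F}, p != 0 /\ root (map_poly iota p) z.
    exists (map_poly (in_alg F) r); rewrite map_poly_eq0 monic_neq0 //.
    split=> //; rewrite -map_poly_comp (eq_map_poly ratE).
    by rewrite rz.
  case=> p; have [n] := ubnP (size p); elim: n p => // n IHn p pn [p0 pz].
  have [[q [qz q0 qp]]|no] := classic (exists q : {poly F},
      [/\ root (map_poly iota q) z, q != 0 & (size q < size p)%N]).
    by apply: (IHn q) => //; apply: leq_trans qp _.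
  exists p; split=> // q qz q0; rewrite leqNgt; apply/negP => qp.
  by apply: no; exists q.
have irr := (subfx_irreducibleP pz p0).1 pmin.
exists (SubFieldExtType pz irr), (@subfx_inj _ _ iota z p); split.
  exact: (subfx_inj_base pz p0).
move=> x; rewrite sE => /mapP[q _ ->].
exists (subfx_eval iota z p (map_poly (in_alg F) q)).
have := subfx_inj_eval pz p0 (map_poly (in_alg F) q).
by rewrite -map_poly_comp (eq_map_poly ratE) => <-.
Qed.

(** * Potential density from a good quartic term *)

Lemma smooth_cubic_polar_form n (c : {mpoly algC[n]}) :
  c \is 3.-homog -> smooth_projective_hypersurface c ->
  exists T, [/\ symmetric_tensor T, forall x, c.@[x] = trilinear T x x x &
    forall x, nonzero_vec x -> exists k, trilinear T x x (unit_vec k) != 0].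
Proof.
move=> cH csm; have [T Tsym [cE dE]] := cubic_polar_form cH.
exists T; split=> // x x0; apply: NNPP => no.
have xk k : trilinear T x x (unit_vec k) = 0.
  by apply/eqP; apply: contraT => kN0; case: no; exists k.
have [|k] := csm x x0; last by rewrite dE xk mulr0 eqxx.
by rewrite cE trilinear_sum_unit big1 // => k _; rewrite xk mulr0.
Qed.

Lemma polarization n (T : 'I_n -> 'I_n -> 'I_n -> algC) x y z :
  symmetric_tensor T ->
  let c u := trilinear T u u u in
  6%:R * trilinear T x y z =
    c (lincomb 1 (lincomb 1 x 1 y) 1 z) - c (lincomb 1 x 1 y)
    - c (lincomb 1 x 1 z) - c (lincomb 1 y 1 z) + c x + c y + c z.
Proof.
move=> Tsym c; have lin := trilinear_lincomb Tsym.
have t12 := trilinear_swap12 Tsym; have t23 := trilinear_swap23 Tsym.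
rewrite /c !lin (t12 z x y) (t23 x z y) (t12 y x z) (t12 z y x) (t23 y z x).
rewrite (t12 y x z).
by rewrite (t12 y x x) (t12 z x x) (t12 y x y) (t12 z y y) (t12 z x z) (t12 z y
  z); ring.
Qed.

Lemma rmorph_range_subfield (K : fieldType) (j : {rmorphism K -> algC}) :
  subfield_pred (fun x => exists a, x = j a).
Proof.
split=> [|_ _ [a ->] [b ->]|_ _ [a ->] [b ->]|_ [a ->]].
- by exists 1; rewrite rmorph1.
- by exists (a - b); rewrite rmorphB.
- by exists (a * b); rewrite rmorphM.
- by exists a^-1; rewrite fmorphV.
Qed.

(** Interpolation at [0], [1], [-1] and [2]. *)
Lemma subfield_cubic_coefs (K : algC -> Prop) a b c d : subfield_pred K ->
  (forall r, K r -> K (r ^+ 3 * a + r ^+ 2 * b + r * c + d)) ->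
  [/\ K a, K b, K c & K d].
Proof.
move=> KF Kr; pose E r := r ^+ 3 * a + r ^+ 2 * b + r * c + d.
have Kn k : K k%:R := subfield_nat KF k.
have KD x y : K x -> K y -> K (x + y) by apply: subfieldD.
have KB x y : K x -> K y -> K (x - y) by apply: subfieldB.
have KM x y : K x -> K y -> K (x * y) by apply: subfieldM.
have KV x : K x -> K x^-1 by apply: subfieldV.
have K0 : K (E 0) := Kr _ (Kn 0).
have K1 : K (E 1) := Kr _ (Kn 1).
have K2 : K (E 2%:R) := Kr _ (Kn 2).
have KN : K (E (-1)) by apply: Kr; apply: subfieldN => //; apply: (Kn 1).
have dE : d = E 0 by rewrite /E; ring.
have bE : b = (E 1 + E (-1)) * 2%:R^-1 - E 0 by rewrite /E; field.
have aE : a = (E 2%:R - 4%:R * b - E 0 - (E 1 - E (-1))) * 6%:R^-1.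
  by rewrite /E; field.
have cE : c = (E 1 - E (-1)) * 2%:R^-1 - a by rewrite /E; field.
have Kd : K d by rewrite dE.
have Kb : K b by rewrite bE; apply: (KB) => //; apply: (KM); [exact: KD|exact:
  KV].
have Ka : K a.
  rewrite aE; apply: (KM); last exact: KV.
  apply: (KB); last exact: KB.
  by apply: (KB) => //; apply: (KB) => //; apply: (KM).
by split=> //; rewrite cE; apply: (KB) => //; apply: (KM); [exact: KB|exact:
  KV].
Qed.

(** Over a number field that contains the coordinates of the triple point, a
    line of the threefold [c3(z) = w ^ 3] and the cube roots of unity, the
    rational points are already dense. *)
Lemma potentially_dense_of_quartic_term (F : fieldExtType rat)
    (iota : {rmorphism F -> algC}) (f : {mpoly F[5]}) (p : 'I_5 -> algC) i
    (h := local_equation (map_mpoly iota f) p i) (x0 : 'I_4 -> algC) :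
  f \is 6.-homog -> p i != 0 -> multiplicity_at_origin h 3 ->
  smooth_projective_hypersurface (pihomog mdeg 3 h) ->
  (pihomog mdeg 3 h).@[x0] = 0 -> (pihomog mdeg 4 h).@[x0] != 0 ->
  potentially_dense iota f.
Proof.
move=> fH pi0 h3 hsm c30 c40.
have fiH : map_mpoly iota f \is 6.-homog := dhomog_map_mpoly iota fH.
have [T [Tsym c3E Tsmooth]] := smooth_cubic_polar_form (pihomogP _ 3 h) hsm.
have [q [v [q0 tqqq tqqv tqvv lineN0]]] := osculating_line_exists Tsym Tsmooth.
pose w0 := 3.-root (trilinear T v v v).
have tvvv : trilinear T v v v = w0 ^+ 3 by rewrite rootCK.
have [e e3] := C_prim_root_exists (isT : 0 < 3)%N.
pose ph j := p j / p i.
have [K [j [jF Ks]]] := number_field_containing iota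
  (w0 :: e :: codom ph ++ codom q ++ codom v).
exists K, j; split=> // d g _ gK x [_ /triple_cover_eq0 xE].
pose Kp x := exists a, x = j a.
have KF : subfield_pred Kp by exact: rmorph_range_subfield.
have Kw0 : Kp w0 by apply: Ks; rewrite inE eqxx.
have Ke : Kp e by apply: Ks; rewrite !inE eqxx orbT.
have Kph k : Kp (ph k) by apply: Ks; rewrite !inE !mem_cat codom_f !orbT.
have Kq k : Kp (q k) by apply: Ks; rewrite !inE !mem_cat codom_f !orbT.
have Kv k : Kp (v k) by apply: Ks; rewrite !inE !mem_cat codom_f !orbT.
have fj : map_mpoly iota f = map_mpoly j (map_mpoly (in_alg K) f).
  by apply/mpolyP => m; rewrite !mcoeff_map_mpoly /= jF.
have lift_vec n (y : 'I_n -> algC) : (forall k, Kp (y k)) ->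
    exists a : 'I_n -> K, y = fun k => j (a k).
  move=> Ky; have [a Ea] := fin_all_exists Ky.
  by exists a; apply: functional_extensionality.
have Kf y : (forall k, Kp (y k)) -> Kp (map_mpoly iota f).@[y].
  move=> /lift_vec[a ->]; rewrite fj meval_map_mpoly.
  by exists (map_mpoly (in_alg K) f).@[a].
have fE r z := triple_point_expansion fiH pi0 h3 r z; rewrite -/h -/ph in fE.
have Kc z : (forall k, Kp (z k)) -> [/\ Kp (pihomog mdeg 3 h).@[z],
    Kp (pihomog mdeg 4 h).@[z], Kp (pihomog mdeg 5 h).@[z] &
    Kp (pihomog mdeg 6 h).@[z]].
  move=> Kz.
  have Kr r : Kp r -> Kp (map_mpoly iota f).@[lincomb 1 (chart_vec i z) r ph].
    move=> Kr; apply: Kf => k; apply: subfieldD => //; apply: subfieldM => //.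
      exact: subfield1.
    by rewrite /chart_vec; case: unliftP => [l _|_]; [exact: Kz | exact:
      subfield0].
  by apply: subfield_cubic_coefs KF _ => r /Kr; rewrite fE.
have KT a b c : (forall k, Kp (a k)) -> (forall k, Kp (b k)) ->
    (forall k, Kp (c k)) -> Kp (trilinear T a b c).
  move=> Ka Kb Kc'; have K1 := subfield1 KF.
  have Klin u y : (forall k, Kp (u k)) -> (forall k, Kp (y k)) ->
      forall k, Kp (lincomb 1 u 1 y k).
    by move=> Ku Ky k; apply: subfieldD => //; apply: subfieldM.
  have Kval u : (forall k, Kp (u k)) -> Kp (trilinear T u u u).
    by move=> Ku; rewrite -c3E; have [] := Kc u Ku.
  have -> : trilinear T a b c = 6%:R^-1 * (6%:R * trilinear T a b c).
    by rewrite mulKf // pnatr_eq0.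
  apply: subfieldM => //; first by apply: (subfieldV KF); apply: subfield_nat.
  rewrite (polarization a b c Tsym) /=.
  do 3!(apply: subfieldD => //; last by apply: (Kval)).
  do 3!(apply: subfieldB => //; last by apply: (Kval); apply: (Klin)).
  by apply: (Kval); apply: (Klin) => //; apply: (Klin).
have phi1 : ph i = 1 by rewrite /ph divff.
have -> : x = cover_point (fun k => x (widen_ord (leqnSn 5) k)) (x ord_max).
  apply: functional_extensionality => k; rewrite /cover_point.
  case: unliftP => [l ->|->] //; congr x; apply: val_inj.
  by rewrite /= /bump leqNgt ltn_ord.
apply: (rational_points_dense_on_cover phi1 fE Tsym Tsmooth c3E KF Kph Kc KT Ke
  e3
  Kq Kv Kw0 q0 lineN0 tqqq tqqv tqvv tvvv c30 c40) => // y w Ky Kw w1 wE.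
have [|b Eb] := lift_vec _ (cover_point y w).
  by move=> k; rewrite /cover_point; case: (unlift _ k).
apply: gK; exists b; split; last by move=> k; rewrite Eb.
have bj k : j (b k) = cover_point y w k by rewrite Eb.
split.
  by exists ord_max; rewrite -(fmorph_eq0 j) bj cover_point_max.
apply/triple_cover_eq0/(fmorph_inj j).
rewrite rmorphXn bj cover_point_max wE -meval_map_mpoly fj.
by apply: meval_eq => k; rewrite bj cover_point_widen.
Qed.

(** * Sextics without quartic term at a point *)

Lemma dhomog_comp n m d (P : {mpoly algC[n]}) (l : n.-tuple {mpoly algC[m]}) :
  P \is d.-homog -> (forall i, tnth l i \is 1.-homog) -> P \mPo l \is d.-homog.
Proof.
move=> PH lH; rewrite comp_mpolyEX big_seq; apply: rpred_sum => mm /(dhomog_mf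
  PH).
rewrite /= => <-; apply: rpredZ; rewrite comp_mpolyX mdegE.
elim/big_rec2: _ => [|i d' q _ qH]; first exact: dhomog1.
apply: dhomogM => //; have := dhomogMn (mm i) (lH i).
by rewrite mul1n.
Qed.

Definition invariant_along (p : 'I_5 -> algC) (P : {mpoly algC[5]}) : Prop :=
  forall x s, P.@[lincomb 1 x s p] = P.@[x].

(** When [M] does not vanish at [p], take [M] as the first coordinate and [p] as
    the point where the other coordinates vanish: the expansion of the sextic at
    [p] starts with the cubic term [C] and has no term of degree four. *)
Definition quartic_free (f : {mpoly algC[5]}) : Prop :=
  exists p M C Q5 Q6, [/\ nonzero_vec p,
    [/\ M \is 1.-homog, C \is 3.-homog, Q5 \is 5.-homog & Q6 \is 6.-homog],
    [/\ invariant_along p C, invariant_along p Q5 & invariant_along p Q6] &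
    f = M ^+ 3 * C + M * Q5 + Q6].

Lemma quartic_free_homog f : quartic_free f -> f \is 6.-homog.
Proof.
move=> [p [M [C [Q5 [Q6 [_ [MH CH Q5H Q6H] _ ->]]]]]].
rewrite !rpredD //; first exact: (dhomogM (dhomogMn 3 MH) CH).
exact: (dhomogM MH Q5H).
Qed.

Lemma quartic_freeZ f a : quartic_free f -> quartic_free (a *: f).
Proof.
move=> [p [M [C [Q5 [Q6 [p0 [MH CH Q5H Q6H] [Ci Q5i Q6i] ->]]]]]].
exists p, M, (a *: C), (a *: Q5), (a *: Q6); split=> //.
- by split=> //; apply: rpredZ.
- by split=> x s; rewrite !mevalZ ?Ci ?Q5i ?Q6i.
- by rewrite !scalerDr !scalerAr.
Qed.

(** Completing the cube removes a quartic term that is a multiple of the cubic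
    one. *)
Lemma quartic_free_of_multiple f p i (h := local_equation f p i)
    (l : 'I_4 -> algC) :
  f \is 6.-homog -> p i != 0 -> multiplicity_at_origin h 3 ->
  (forall z, (pihomog mdeg 4 h).@[z] =
     (\sum_k l k * z k) * (pihomog mdeg 3 h).@[z]) ->
  quartic_free f.
Proof.
move=> fH pi0 h3 h4; pose ph j := p j / p i.
have ph1 : ph i = 1 by rewrite /ph divff.
pose zt : 4.-tuple {mpoly algC[5]} :=
  [tuple 'X_(lift i k) - ph (lift i k) *: 'X_i | k < 4].
have ztH k : tnth zt k \is 1.-homog.
  by rewrite tnth_mktuple rpredB ?rpredZ // dhomogX /= mdeg1.
pose z x k := x (lift i k) - x i * ph (lift i k).
have zE x : (fun k => (tnth zt k).@[x]) = z x.
  apply: functional_extensionality => k.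
  by rewrite tnth_mktuple mevalB mevalZ !mevalXU mulrC.
pose lf : {mpoly algC[4]} := \sum_k l k *: 'X_k.
have lfH : lf \is 1.-homog.
  by apply: rpred_sum => k _; rewrite rpredZ // dhomogX /= mdeg1.
have lfE y : lf.@[y] = \sum_k l k * y k.
  by rewrite raddf_sum; apply: eq_bigr => k _ /=; rewrite mevalZ mevalXU.
pose c k := pihomog mdeg k h.
have cH k : c k \is k.-homog by exact: pihomogP.
pose q5 := c 5 - 3%:R^-1 *: (lf ^+ 2 * c 3).
pose q6 := c 6 - 27%:R^-1 *: (lf ^+ 3 * c 3) - 3%:R^-1 *: (lf * q5).
have q5H : q5 \is 5.-homog.
  by rewrite rpredB ?rpredZ // (dhomogM (dhomogMn 2 lfH) (cH 3)).
have q6H : q6 \is 6.-homog.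
  rewrite rpredB ?rpredZ ?(dhomogM lfH q5H) // rpredB ?rpredZ //.
  exact: (dhomogM (dhomogMn 3 lfH) (cH 3)).
have inv (P : {mpoly algC[4]}) : invariant_along ph (P \mPo zt).
  move=> x s; rewrite !comp_mpoly_meval !zE; apply: meval_eq => k.
  by rewrite /z /lincomb ph1; ring.
exists ph, ('X_i + 3%:R^-1 *: (lf \mPo zt)), (c 3 \mPo zt), (q5 \mPo zt),
  (q6 \mPo zt); split.
- by exists i; rewrite ph1 oner_eq0.
- split; last by apply: dhomog_comp.
  + by rewrite rpredD ?rpredZ ?dhomogX //= ?mdeg1 // dhomog_comp.
  + by apply: dhomog_comp.
  + by apply: dhomog_comp.
- by split.
apply: meval_inj_alg => x.
have -> : f.@[x] = f.@[lincomb 1 (chart_vec i (z x)) (x i) ph].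
  apply: meval_eq => j; rewrite /lincomb mul1r.
  have [k ->|->] := unliftP i j; first by rewrite chart_vec_lift subrK.
  by rewrite chart_vec_self add0r ph1 mulr1.
rewrite (triple_point_expansion fH pi0 h3).
rewrite !(meval_exp, mevalD, mevalM, mevalZ, mevalXU) !comp_mpoly_meval !zE h4.
rewrite /q6 /q5 !(meval_exp, mevalB, mevalZ, mevalM) lfE -/(c 3).
move: (\sum_k _) => ll; move: (c 3).@[_] => a3.
rewrite -/h -/(c 5) -/(c 6); move: (c 5).@[_] (c 6).@[_] => a5 a6.
by field.
Qed.

(** * Linear changes of coordinates *)

Definition mat_vec (A : 'M[algC]_5) (x : 'I_5 -> algC) : 'I_5 -> algC :=
  fun i => \sum_(j < 5) A i j * x j.

Lemma mat_vecK (A : 'M[algC]_5) x : A \in unitmx ->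
  mat_vec A (mat_vec (invmx A) x) = x.
Proof.
move=> Au; apply: functional_extensionality => i.
pose X : 'cV[algC]_5 := \col_j x j.
have : (A *m (invmx A *m X)) i 0 = X i 0 by rewrite mulKVmx.
rewrite !mxE => <-; apply: eq_bigr => j _; rewrite mxE; congr (_ * _).
by apply: eq_bigr => k _; rewrite mxE.
Qed.

Lemma mat_vec_lincomb A x s y :
  mat_vec A (lincomb 1 x s y) = lincomb 1 (mat_vec A x) s (mat_vec A y).
Proof.
apply: functional_extensionality => i; rewrite /mat_vec /lincomb mul1r.
rewrite big_distrr -big_split; apply: eq_bigr => j _ /=; ring.
Qed.

Lemma meval_linear_substitution A f x :
  (linear_substitution A f).@[x] = f.@[mat_vec A x].
Proof.
rewrite /linear_substitution comp_mpoly_meval; apply: meval_eq => i.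
rewrite tnth_mktuple raddf_sum; apply: eq_bigr => j _ /=.
by rewrite mevalZ mevalXU.
Qed.

Lemma linear_substitution_homog A d f :
  f \is d.-homog -> linear_substitution A f \is d.-homog.
Proof.
move=> fH; apply: dhomog_comp => // i; rewrite tnth_mktuple.
by apply: rpred_sum => j _; rewrite rpredZ // dhomogX /= mdeg1.
Qed.

Lemma linear_substitutionK A f : A \in unitmx ->
  linear_substitution (invmx A) (linear_substitution A f) = f.
Proof.
move=> Au; apply: meval_inj_alg => x.
by rewrite !meval_linear_substitution mat_vecK.
Qed.

Lemma quartic_free_linear_substitution A f : A \in unitmx ->
  quartic_free f -> quartic_free (linear_substitution A f).
Proof.
move=> Au [p [M [C [Q5 [Q6 [[i pi0] [MH CH Q5H Q6H] [Ci Q5i Q6i] ->]]]]]].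
exists (mat_vec (invmx A) p), (linear_substitution A M), (linear_substitution A
  C),
  (linear_substitution A Q5), (linear_substitution A Q6); split.
- apply: NNPP => no; case/eqP: pi0.
  rewrite -(mat_vecK p Au) /mat_vec big1 // => j _.
  rewrite -/(mat_vec (invmx A) p j) (_ : mat_vec _ _ _ = 0) ?mulr0 //.
  by apply/eqP; apply: contraT => j0; case: no; exists j.
- by split; apply: linear_substitution_homog.
- by split=> x s; rewrite !meval_linear_substitution mat_vec_lincomb mat_vecK
    // ?Ci ?Q5i ?Q6i.
- apply: meval_inj_alg => x; rewrite meval_linear_substitution.
  by rewrite !(meval_exp, mevalD, mevalM) !meval_linear_substitution.
Qed.

(** * The Zariski closure of the quartic-free sextics *)

(** Coordinates of the triple point would have to be eliminated to describe the
    quartic-free sextics by equations.  Their closure is closed by definition,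
    and what remains is to show that it is not everything. *)
Definition quartic_free_closure (f : {mpoly algC[5]}) : Prop :=
  forall P : {mpoly algC[#|sextic_monomials|]},
    (forall b, quartic_free b -> P.@[sextic_coords b] = 0) ->
    P.@[sextic_coords f] = 0.

Lemma sextic_coordsZ a f k : sextic_coords (a *: f) k = a * sextic_coords f k.
Proof. by rewrite /sextic_coords mcoeffZ. Qed.

Lemma sextic_expansion f : f \is 6.-homog ->
  f = \sum_(k < #|sextic_monomials|)
        sextic_coords f k *: 'X_[bmnm (enum_val k)].
Proof.
move=> fH; apply/mpolyP => m; rewrite raddf_sum /=.
have [m6|m6] := eqVneq (mdeg m) 6%N; last first.
  rewrite (dhomog_nemf_coeff fH m6) big1 // => k _; rewrite mcoeffZ mcoeffX.
  have [E|_] := eqVneq; last by rewrite mulr0.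
  by have := enum_valP k; rewrite unfold_in /= E (negPf m6).
have m7 : (mdeg m < 7)%N by rewrite m6.
pose b := BMultinom m7; have bS : b \in sextic_monomials by rewrite unfold_in
  /= m6.
rewrite (bigD1 (enum_rank_in bS b)) //= big1 => [|k kb].
  by rewrite addr0 mcoeffZ mcoeffX /sextic_coords enum_rankK_in //= eqxx mulr1.
rewrite mcoeffZ mcoeffX; case: eqP => [E|]; last by rewrite mulr0.
case/eqP: kb; apply: enum_val_inj; rewrite enum_rankK_in //.
exact: val_inj.
Qed.

Lemma quartic_free_closure_closed :
  exists E : {mpoly algC[#|sextic_monomials|]} -> Prop,
     (forall P, E P -> exists d, P \is d.-homog) /\
     (forall f, triple_point_sextic f ->
        (quartic_free_closure f <-> forall P, E P -> P.@[sextic_coords f] = 0)).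
Proof.
exists (fun P => (exists d, P \is d.-homog) /\
  forall b, quartic_free b -> P.@[sextic_coords b] = 0).
split=> [P []//|f _]; split=> [Zf P [_ PB]|EZ P PB]; first exact: Zf.
rewrite (pihomog_partitionE (leqnn (msize P))) raddf_sum big1 //= => d _.
apply: EZ; split; first by exists d; apply: pihomogP.
(* The quartic-free sextics form a cone. *)
move=> b bB; pose q : {poly algC} :=
  \poly_(k < msize P) (pihomog mdeg k P).@[sextic_coords b].
have q0 : q = 0.
  apply: poly_eq0_nat => n; rewrite horner_poly.
  rewrite -[RHS](PB _ (quartic_freeZ n%:R bB)).
  rewrite [in RHS](pihomog_partitionE (leqnn (msize P))) raddf_sum.
  apply: eq_bigr => k _ /=.
  rewrite mulrC -(meval_dhomog_scale _ _ (pihomogP _ k P)).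
  by apply: meval_eq => l; rewrite sextic_coordsZ.
by have := congr1 (fun r : {poly algC} => r`_d) q0; rewrite coef_poly ltn_ord
  coef0.
Qed.

Lemma quartic_free_closure_substitution A f :
  A \in unitmx -> f \is 6.-homog ->
  quartic_free_closure f -> quartic_free_closure (linear_substitution A f).
Proof.
move=> Au fH Zf P PB.
pose a k (l : 'I_#|sextic_monomials|) :=
  sextic_coords (linear_substitution A 'X_[bmnm (enum_val l)]) k.
pose act : _.-tuple {mpoly algC[#|sextic_monomials|]} :=
  [tuple \sum_(l < #|sextic_monomials|) a k l *: 'X_l | k <
    #|sextic_monomials|].
have actE g : g \is 6.-homog ->
    (P \mPo act).@[sextic_coords g] = P.@[sextic_coords (linear_substitution A
      g)].
  move=> gH; rewrite comp_mpoly_meval; apply: meval_eq => k.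
  rewrite tnth_mktuple {2}(sextic_expansion gH) /linear_substitution.
  rewrite !raddf_sum /sextic_coords raddf_sum; apply: eq_bigr => l _ /=.
  by rewrite mevalZ mevalXU comp_mpolyZ mcoeffZ mulrC.
rewrite -actE //; apply: Zf => b bB.
rewrite actE; last exact: quartic_free_homog.
by apply/PB/quartic_free_linear_substitution.
Qed.

Lemma quartic_free_closure_closed_in_moduli :
  closed_in_moduli quartic_free_closure.
Proof.
split; first exact: quartic_free_closure_closed.
move=> f A [[_ fH] _] Au; split=> Zf; last exact:
  quartic_free_closure_substitution.
rewrite -(linear_substitutionK f Au).
apply: quartic_free_closure_substitution => //; first by rewrite unitmx_inv.
exact: linear_substitution_homog.
Qed.

(** * Algebraic dependence *)

Lemma msize_mul_le (R : idomainType) n (P Q : {mpoly R[n]}) k l :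
  (msize P <= k.+1)%N -> (msize Q <= l.+1)%N -> (msize (P * Q) <= (k + l).+1)%N.
Proof.
move=> Pk Ql; have [->|P0] := eqVneq P 0; first by rewrite mul0r msize0.
have [->|Q0] := eqVneq Q 0; first by rewrite mulr0 msize0.
by rewrite msizeM //; lia.
Qed.

Lemma msize_exp_le (R : idomainType) n (P : {mpoly R[n]}) k e :
  (msize P <= k.+1)%N -> (msize (P ^+ e) <= (k * e).+1)%N.
Proof.
move=> Pk; elim: e => [|e IHe]; first by rewrite muln0 msize1.
by rewrite exprS mulnS msize_mul_le.
Qed.

(** More polynomials than variables are algebraically dependent: their monomials
    with exponents smaller than [D] are [D ^ m] polynomials in a space whose
    dimension grows only like [D ^ n]. *)
Lemma algebraic_dependence (F : fieldType) n m (psi : 'I_m -> {mpoly F[n]}) :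
  (n < m)%N -> exists2 P : {mpoly F[m]}, P != 0 &
    P \mPo [tuple psi i | i < m] = 0.
Proof.
move=> nm; pose d := (\sum_(i < m) msize (psi i))%N.
pose D := ((m * d + 1) ^ n).+1; pose E := (m * d * D + 1)%N.
pose mA (e : {ffun 'I_m -> 'I_D}) : 'X_{1..m} := [multinom (e i : nat) | i < m].
pose mB (e : {ffun 'I_n -> 'I_E}) : 'X_{1..n} := [multinom (e i : nat) | i < n].
have mA_inj : injective mA.
  move=> e e' /mnmP ee; apply/ffunP => i; apply: val_inj.
  by have := ee i; rewrite !mnmE.
pose q e := 'X_[mA e] \mPo [tuple psi i | i < m].
have card_lt : (#|{ffun 'I_n -> 'I_E}| < #|{ffun 'I_m -> 'I_D}|)%N.
  rewrite !card_ffun !card_ord; apply: (@leq_trans (D ^ n.+1)); last first.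
    by rewrite leq_exp2l // /D ltnS expn_gt0 addn1.
  rewrite expnS; apply: (@leq_ltn_trans ((m * d + 1) ^ n * D ^ n)).
    rewrite -expnMn; have [->//|n0] := posnP n.
    by rewrite leq_exp2r // /E /D mulnDl mul1n leq_add2l.
  by rewrite ltn_mul2r expn_gt0 /= /D ltnSn.
have msize_q e : (msize (q e) <= E)%N.
  rewrite /q comp_mpolyX /E addn1.
  apply: (@leq_trans (\sum_(i < m) d * D).+1); last first.
    by rewrite sum_nat_const card_ord mulnA.
  elim/big_rec2: _ => [|i k R _ Rk]; first by rewrite msize1.
  apply: msize_mul_le => //; rewrite tnth_mktuple mnmE.
  have di : (msize (psi i) <= d.+1)%N.
    by rewrite leqW // /d (bigD1 i) //= leq_addr.
  apply: leq_trans (msize_exp_le (e i) di) _.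
  by rewrite ltnS leq_mul2l ltnW ?orbT.
pose M := \matrix_(a < #|{ffun 'I_m -> 'I_D}|, b < #|{ffun 'I_n -> 'I_E}|)
  (q (enum_val a))@_(mB (enum_val b)).
have : kermx M != 0.
  rewrite -mxrank_eq0 mxrank_ker subn_eq0 -ltnNge.
  exact: leq_ltn_trans (rank_leq_col _) card_lt.
case/rowV0Pn => u /sub_kermxP uM /eqP u0.
exists (\sum_a u 0 a *: 'X_[mA (enum_val a)]).
  apply/eqP => P0; apply: u0; apply/rowP => a; rewrite mxE.
  have := congr1 (mcoeff (mA (enum_val a))) P0.
  rewrite mcoeff0 raddf_sum (bigD1 a) //= big1 => [|b ba].
    by rewrite addr0 mcoeffZ mcoeffX eqxx mulr1.
  rewrite mcoeffZ mcoeffX (inj_eq mA_inj) (inj_eq enum_val_inj).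
  by rewrite (negPf ba) mulr0.
apply/mpolyP => mu; rewrite (raddf_sum (comp_mpoly _)) /= raddf_sum mcoeff0 /=.
under eq_bigr => a _ do rewrite comp_mpolyZ mcoeffZ -/(q _).
have [muE|/forallPn[i]] := boolP [forall i, mu i < E]%N; last first.
  rewrite -leqNgt => Emu; apply: big1 => a _.
  rewrite memN_msupp_eq0 ?mulr0 // msize_mdeg_ge //.
  apply: leq_trans (msize_q _) (leq_trans Emu _).
  by rewrite mdegE (bigD1 i) //= leq_addr.
pose b : {ffun 'I_n -> 'I_E} := [ffun i => Ordinal (forallP muE i)].
have bE : mu = mB b by apply/mnmP => i; rewrite mnmE ffunE.
have /rowP/(_ (enum_rank b)) := uM; rewrite !mxE => bM; rewrite -[RHS]bM.
by apply: eq_bigr => a _; rewrite mxE enum_rankK bE.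
Qed.

(** * Polynomial families of polynomials *)

Section PolyFamilies.

Variables n N : nat.

Definition polyfamily (Phi : ('I_n -> algC) -> {mpoly algC[N]}) : Prop :=
  forall m, polyfun (fun v => (Phi v)@_m).

Lemma polyfamilyC P : polyfamily (fun _ => P).
Proof. by move=> m; apply: polyfunC. Qed.

Lemma polyfamilyD Phi Psi :
  polyfamily Phi -> polyfamily Psi -> polyfamily (fun v => Phi v + Psi v).
Proof.
move=> PP PQ m; apply: (eq_polyfun (phi := fun v => (Phi v)@_m + (Psi v)@_m)).
  by move=> v; rewrite mcoeffD.
by apply: polyfunD.
Qed.

Lemma polyfamilyZ phi Phi :
  polyfun phi -> polyfamily Phi -> polyfamily (fun v => phi v *: Phi v).
Proof.
move=> Pp PP m; apply: (eq_polyfun (phi := fun v => phi v * (Phi v)@_m)).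
  by move=> v; rewrite mcoeffZ.
by apply: polyfunM.
Qed.

Lemma polyfamilyM Phi Psi :
  polyfamily Phi -> polyfamily Psi -> polyfamily (fun v => Phi v * Psi v).
Proof.
move=> PP PQ m; apply: (eq_polyfun (phi := fun v =>
  \sum_(k : 'X_{1..N < (mdeg m).+1, (mdeg m).+1} | m == (k.1 + k.2)%MM)
    (Phi v)@_k.1 * (Psi v)@_k.2)).
  by move=> v; rewrite mcoeffM.
apply: (polyfun_sum _ _ (phi := fun (k : 'X_{1..N < (mdeg m).+1, (mdeg m).+1})
  v =>
  (Phi v)@_k.1 * (Psi v)@_k.2)) => k.
by apply: polyfunM.
Qed.

Lemma polyfamilyX Phi k : polyfamily Phi -> polyfamily (fun v => Phi v ^+ k).
Proof.
move=> PP; elim: k => [|k IHk]; first exact: (polyfamilyC 1).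
by move=> m; apply: eq_polyfun (polyfamilyM PP IHk m) => v; rewrite exprS.
Qed.

Lemma polyfamily_sum (I : Type) (r : seq I) Phi :
  (forall a : I, polyfamily (Phi a)) ->
  polyfamily (fun v => \sum_(a <- r) Phi a v).
Proof.
move=> PP m; apply: (eq_polyfun (phi := fun v => \sum_(a <- r) (Phi a v)@_m)).
  by move=> v; rewrite raddf_sum.
by apply: (polyfun_sum _ _ (phi := fun a v => (Phi a v)@_m)) => a; apply: PP.
Qed.

Lemma polyfamily_prod (I : Type) (r : seq I) Phi :
  (forall a : I, polyfamily (Phi a)) ->
  polyfamily (fun v => \prod_(a <- r) Phi a v).
Proof.
move=> PP; elim: r => [|a r IHr] m.
  by apply: eq_polyfun (polyfamilyC 1 m) => v; rewrite big_nil.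
by apply: eq_polyfun (polyfamilyM (PP a) IHr m) => v; rewrite big_cons.
Qed.

End PolyFamilies.

(** * Counting parameters *)

Definition monomials (k : nat) : seq 'X_{1..4} :=
  [seq s2m t | t : k.-tuple 'I_4 <- enum (basis 4 k)].

Lemma size_monomials k : size (monomials k) = 'C(k + 3, k).
Proof. exact: (mpoly.size_basis 3 k). Qed.

Lemma monomials_uniq k : uniq (monomials k).
Proof. exact: (mpoly.uniq_basis 4 k). Qed.

Lemma mem_monomials k m : (m \in monomials k) = (mdeg m == k).
Proof. by rewrite (basis_cover k m). Qed.

Lemma monomials_expansion k (P : {mpoly algC[4]}) : P \is k.-homog ->
  P = \sum_(a < size (monomials k))
        P@_(nth 0%MM (monomials k) a) *: 'X_[nth 0%MM (monomials k) a].
Proof.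
move=> PH; rewrite -(big_mkord xpredT (fun a =>
  P@_(nth 0%MM (monomials k) a) *: 'X_[nth 0%MM (monomials k) a])).
rewrite -(big_nth 0%MM xpredT (fun m => P@_m *: 'X_[m])).
apply/mpolyP => m; rewrite raddf_sum /=.
have [mk|mk] := boolP (m \in monomials k).
  rewrite (bigD1_seq m) ?monomials_uniq //= mcoeffZ mcoeffX eqxx mulr1.
  rewrite big1 ?addr0 // => m' /negPf mm'.
  by rewrite mcoeffZ mcoeffX mm' mulr0.
rewrite (dhomog_nemf_coeff PH) -?mem_monomials // big_seq big1 // => m' m'k.
rewrite mcoeffZ mcoeffX; case: eqP => [E|]; last by rewrite mulr0.
by rewrite -E m'k in mk.
Qed.

Lemma linear_form_expansion n (P : {mpoly algC[n]}) : P \is 1.-homog ->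
  P = \sum_(j < n) P@_U_(j) *: 'X_j.
Proof.
move=> PH; apply/mpolyP => m; rewrite raddf_sum /=.
have [/eqP/mdeg1P[j /eqP ->]|m1] := eqVneq (mdeg m) 1%N.
  rewrite (bigD1 j) //= mcoeffZ mcoeffX eqxx mulr1 big1 ?addr0 // => k kj.
  by rewrite mcoeffZ mcoeffX eq_mnm1 (negPf kj) mulr0.
rewrite (dhomog_nemf_coeff PH m1) big1 // => j _; rewrite mcoeffZ mcoeffX.
by case: eqP => [E|]; [rewrite -E mdeg1 in m1 | rewrite mulr0].
Qed.

Local Notation ix k := ('I_(size (monomials k))).

(** Parameters of quartic-free sextics: the point, the linear form, and the
    coefficients of the forms of degrees 3, 5 and 6 in four variables. *)
Definition parameter : finType :=
  ('I_5 + 'I_5 + (ix 3 + ix 5 + ix 6))%type.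

Lemma card_parameter : #|parameter| = 170.
Proof. by rewrite !card_sum !card_ord !size_monomials. Qed.

Section Family.

Variables (i : 'I_5) (v : 'I_#|parameter| -> algC).

Let par (a : parameter) := v (enum_rank a).

(** The coordinates [p i * 'X_(lift i k) - p (lift i k) * 'X_i] vanish at [p] and
    are polynomial in [p]; the powers of [p i] by which they differ from affine
    coordinates are absorbed in the coefficients. *)
Definition family_coord (k : 'I_4) : {mpoly algC[5]} :=
  par (inl (inl i)) *: 'X_(lift i k) + (- par (inl (inl (lift i k)))) *: 'X_i.

Definition family_form d (inj : ix d -> parameter) : {mpoly algC[5]} :=
  \sum_(a < size (monomials d)) par (inj a) *:
    \prod_(l < 4) family_coord l ^+ nth 0%MM (monomials d) a l.

Definition family_linear_form : {mpoly algC[5]} :=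
  \sum_(j < 5) par (inl (inr j)) *: 'X_j.

Definition quartic_free_family : {mpoly algC[5]} :=
  family_linear_form ^+ 3 * family_form (fun a : ix 3 => inr (inl (inl a)))
  + family_linear_form * family_form (fun a : ix 5 => inr (inl (inr a)))
  + family_form (fun a : ix 6 => inr (inr a)).

End Family.

Lemma quartic_free_family_polyfamily i : polyfamily (quartic_free_family i).
Proof.
have Ppar (a : parameter) : polyfun (fun v => v (enum_rank a)).
  exact: polyfun_coord.
have Pcoord k : polyfamily (fun v => family_coord i v k).
  apply: polyfamilyD; apply: polyfamilyZ => //; try exact: polyfamilyC.
  exact: polyfunN.
have Pform d inj : polyfamily (fun v => family_form i v (d := d) inj).
  apply: (polyfamily_sum _ (Phi := fun (a : ix d) v => v (enum_rank (inj a)) *: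
    \prod_(l < 4) family_coord i v l ^+ nth 0%MM (monomials d) a l)) => a.
  apply: polyfamilyZ => //.
  apply: (polyfamily_prod _ (Phi := fun (l : 'I_4) v =>
    family_coord i v l ^+ nth 0%MM (monomials d) a l)) => l.
  exact: polyfamilyX.
have Plin : polyfamily (fun v => family_linear_form v).
  apply: (polyfamily_sum _ (Phi := fun (j : 'I_5) v =>
    v (enum_rank (inl (inr j) : parameter)) *: 'X_j)) => j.
  by apply: polyfamilyZ => //; apply: polyfamilyC.
apply: polyfamilyD; last exact: Pform.
apply: polyfamilyD; apply: polyfamilyM => //; exact: polyfamilyX.
Qed.

(** A form that is invariant along [p] takes the same value at [x] and at the
    projection of [x] from [p] to the hyperplane ['X_i = 0]. *)
Lemma invariant_form_expansion d (P : {mpoly algC[5]}) (p : 'I_5 -> algC) i :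
  P \is d.-homog -> invariant_along p P -> p i != 0 ->
  exists c : ix d -> algC, forall x, P.@[x] = \sum_(a < size (monomials d))
    c a * \prod_(l < 4) (p i * x (lift i l) - p (lift i l) * x i)
      ^+ nth 0%MM (monomials d) a l.
Proof.
move=> PH Pinv pi0.
pose R := P \mPo [tuple (if unlift i j is Some k then 'X_k else 0) | j < 5]
  : {mpoly algC[4]}.
have RH : R \is d.-homog.
  apply: dhomog_comp => // j; rewrite tnth_mktuple.
  by case: (unlift i j) => [k|]; rewrite ?dhomogX /= ?mdeg1 ?dhomog0.
have RE z : R.@[z] = P.@[chart_vec i z].
  rewrite comp_mpoly_meval; apply: meval_eq => j; rewrite tnth_mktuple
    /chart_vec.
  by case: (unlift i j) => [k|]; rewrite ?mevalXU ?meval0.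
exists (fun a => (p i)^-1 ^+ d * R@_(nth 0%MM (monomials d) a)) => x.
rewrite -(Pinv x (- (x i / p i))).
have -> : lincomb 1 x (- (x i / p i)) p = fun j => (p i)^-1 *
    chart_vec i (fun l => p i * x (lift i l) - p (lift i l) * x i) j.
  apply: functional_extensionality => j; rewrite /lincomb.
  have [k ->|->] := unliftP i j; first by rewrite chart_vec_lift; field.
  by rewrite chart_vec_self; field.
rewrite (meval_dhomog_scale _ _ PH) -RE {1}(monomials_expansion RH) raddf_sum.
rewrite big_distrr; apply: eq_bigr => a _ /=.
by rewrite mevalZ mevalX mulrA.
Qed.

Lemma quartic_free_in_family f : quartic_free f ->
  exists i v, f = quartic_free_family i v.
Proof.
move=> [p [M [C [Q5 [Q6 [[i pi0] [MH CH Q5H Q6H] [Ci Q5i Q6i] ->]]]]]].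
have [c3 c3E] := invariant_form_expansion CH Ci pi0.
have [c5 c5E] := invariant_form_expansion Q5H Q5i pi0.
have [c6 c6E] := invariant_form_expansion Q6H Q6i pi0.
pose val (a : parameter) := match a with
  | inl (inl j) => p j | inl (inr j) => M@_U_(j)
  | inr (inl (inl a)) => c3 a | inr (inl (inr a)) => c5 a | inr (inr a) => c6 a
  end.
exists i, (fun k => val (enum_val k)); apply: meval_inj_alg => x.
have coordE k : (family_coord i (fun k => val (enum_val k)) k).@[x] =
    p i * x (lift i k) - p (lift i k) * x i.
  by rewrite /family_coord mevalD !mevalZ !mevalXU !enum_rankK mulNr.
have formE d (inj : ix d -> parameter) :
    (family_form i (fun k => val (enum_val k)) inj).@[x] =
    \sum_(a < size (monomials d)) val (inj a) *
    \prod_(l < 4) (p i * x (lift i l) - p (lift i l) * x i)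
      ^+ nth 0%MM (monomials d) a l.
  rewrite raddf_sum; apply: eq_bigr => a _ /=.
  rewrite mevalZ enum_rankK rmorph_prod; congr (_ * _); apply: eq_bigr => l _
    /=.
  by rewrite meval_exp coordE.
rewrite /quartic_free_family !(meval_exp, mevalD, mevalM) !formE -c3E -c5E -c6E.
rewrite (_ : family_linear_form _ = M) //.
rewrite [RHS](linear_form_expansion MH); apply: eq_bigr => j _.
by rewrite enum_rankK.
Qed.

(** * Sextics outside the closure *)

Definition extend_monomial (e : nat) (m : 'X_{1..4}) : 'X_{1..5} :=
  [multinom (if unlift ord0 j is Some k then m k else e) | j < 5].

Lemma extend_monomial_inj e e' m m' :
  extend_monomial e m = extend_monomial e' m' -> e = e' /\ m = m'.
Proof.
move=> /mnmP E; split.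
  by have := E ord0; rewrite !mnmE unlift_none.
by apply/mnmP => k; have := E (lift ord0 k); rewrite !mnmE liftK.
Qed.

Lemma mdeg_extend_monomial e m : mdeg (extend_monomial e m) = (e + mdeg m)%N.
Proof.
rewrite !mdegE big_ord_recl mnmE unlift_none; congr (_ + _)%N.
by apply: eq_bigr => k _; rewrite mnmE liftK.
Qed.

(** The sextic monomials of degree at most two in the first variable, whose
    coefficients are free once a triple point at the first vertex and its tangent
    cone are prescribed. *)
Definition tail_monomials : seq 'X_{1..5} :=
  [seq extend_monomial 2 m | m <- monomials 4]
  ++ [seq extend_monomial 1 m | m <- monomials 5]
  ++ [seq extend_monomial 0 m | m <- monomials 6].

Lemma size_tail_monomials : size tail_monomials = 175.
Proof. by rewrite !size_cat !(size_map (extend_monomial _)) !size_monomials.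
  Qed.

Lemma tail_monomialsP mu : mu \in tail_monomials ->
  exists e m, [/\ (e < 3)%N, (e + mdeg m = 6)%N & mu = extend_monomial e m].
Proof.
rewrite !mem_cat => /or3P[] /mapP[m mk ->]; rewrite mem_monomials in mk.
- by exists 2, m; rewrite (eqP mk).
- by exists 1%N, m; rewrite (eqP mk).
- by exists 0%N, m; rewrite (eqP mk).
Qed.

Lemma tail_monomials_uniq : uniq tail_monomials.
Proof.
have einj e : injective (extend_monomial e).
  by move=> m m' /extend_monomial_inj[].
have disj e e' k k' : e != e' ->
    ~~ has [in [seq extend_monomial e m | m <- monomials k]]
      [seq extend_monomial e' m | m <- monomials k'].
  move=> ee; apply/hasPn => _ /mapP[m _ ->]; apply/mapP => -[m' _].
  by move=> /extend_monomial_inj[E _]; rewrite E eqxx in ee.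
rewrite !cat_uniq !(map_inj_uniq (einj _)) !monomials_uniq has_cat negb_or.
by rewrite !disj.
Qed.

Local Notation tail_index := 'I_(size tail_monomials).

Definition tail_coords (f : {mpoly algC[5]}) (k : tail_index) : algC :=
  f@_(nth 0%MM tail_monomials k).

(** A triple point with the Fermat cubic as tangent cone, and an arbitrary
    tail. *)
Definition fermat_sextic (u : tail_index -> algC) : {mpoly algC[5]} :=
  \sum_(k < 4) 'X_[extend_monomial 3 (U_(k) *+ 3)]
  + \sum_(k < size tail_monomials) u k *: 'X_[nth 0%MM tail_monomials k].

Lemma tail_coords_fermat u : tail_coords (fermat_sextic u) = u.
Proof.
apply: functional_extensionality => k; rewrite /tail_coords mcoeffD.
have kJ : nth 0%MM tail_monomials k \in tail_monomials by apply: mem_nth.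
rewrite raddf_sum big1 => [|l _ /=]; last first.
  rewrite mcoeffX; case: eqP => // E.
  have [e [m [e3 _]]] := tail_monomialsP kJ; rewrite -E.
  by move=> /extend_monomial_inj[E3]; rewrite -E3 in e3.
rewrite add0r raddf_sum (bigD1 k) //= mcoeffZ mcoeffX eqxx mulr1.
rewrite big1 ?addr0 // => l lk; rewrite mcoeffZ mcoeffX.
by rewrite nth_uniq ?tail_monomials_uniq // (inj_eq val_inj) (negPf lk) mulr0.
Qed.

Lemma local_equation_extend_monomial e m :
  local_equation 'X_[extend_monomial e m] (unit_vec ord0) ord0 = 'X_[m].
Proof.
rewrite /local_equation comp_mpolyX big_ord_recl tnth_mktuple unlift_none.
rewrite expr1n mul1r mpolyXE_id; apply: eq_bigr => k _.
rewrite tnth_mktuple liftK mnmE liftK /unit_vec /= mul0r.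
by rewrite mpolyC0 add0r.
Qed.

Lemma fermat_sextic_triple_point u : triple_point_sextic (fermat_sextic u).
Proof.
pose fermat : {mpoly algC[4]} := \sum_(k < 4) 'X_k ^+ 3.
have U3 (k : 'I_4) : mdeg (U_(k) *+ 3)%MM = 3 by rewrite mdegMn mdeg1.
split.
  split.
    apply/eqP => E; have := congr1 (mcoeff (extend_monomial 3 (U_(ord0) *+ 3)))
      E.
    rewrite mcoeff0 mcoeffD [X in _ + X]raddf_sum [X in _ + X]big1 => [|k _ /=].
      rewrite addr0 raddf_sum (bigD1 ord0) //= mcoeffX eqxx big1 => [|k k0].
        by rewrite addr0 => /eqP; rewrite oner_eq0.
      rewrite mcoeffX; case: eqP => // /extend_monomial_inj[_ /mnmP/(_ ord0)].
      by rewrite !mulmnE !mnm1E (negPf k0).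
    have kJ : nth 0%MM tail_monomials k \in tail_monomials by apply: mem_nth.
    rewrite mcoeffZ mcoeffX; case: eqP => [E'|]; last by rewrite mulr0.
    have [e [m [e3 _]]] := tail_monomialsP kJ; rewrite E'.
    by move=> /extend_monomial_inj[E3]; rewrite -E3 in e3.
  rewrite rpredD //; apply: rpred_sum => k _.
    by rewrite dhomogX /= mdeg_extend_monomial U3.
  apply: rpredZ; rewrite dhomogX /=.
  have [e [m [_ em ->]]] := tail_monomialsP (mem_nth 0%MM (ltn_ord k)).
  by rewrite mdeg_extend_monomial em.
have loc : local_equation (fermat_sextic u) (unit_vec ord0) ord0 =
    fermat + \sum_(k < size tail_monomials) u k *:
      local_equation 'X_[nth 0%MM tail_monomials k] (unit_vec ord0) ord0.
  rewrite /local_equation /fermat_sextic comp_mpolyD.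
  rewrite !(raddf_sum (comp_mpoly _)) /=; congr (_ + _); apply: eq_bigr => k _.
    have := local_equation_extend_monomial 3 (U_(k) *+ 3).
    by rewrite /local_equation => ->; rewrite mpolyXn.
  by rewrite comp_mpolyZ.
have tail0 d : (d < 4)%N -> pihomog mdeg d (\sum_(k < size tail_monomials) u k
  *:
    local_equation 'X_[nth 0%MM tail_monomials k] (unit_vec ord0) ord0) = 0.
  move=> d4; rewrite raddf_sum big1 // => k _ /=; rewrite linearZ /=.
  have [e [m [e3 em ->]]] := tail_monomialsP (mem_nth 0%MM (ltn_ord k)).
  rewrite local_equation_extend_monomial pihomogX /=.
  by case: eqP => [md|]; [lia | rewrite scaler0].
have fH : fermat \is 3.-homog.
  by apply: rpred_sum => k _; rewrite mpolyXn dhomogX /= U3.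
have loc3 : pihomog mdeg 3 (local_equation (fermat_sextic u) (unit_vec ord0)
  ord0)
    = fermat.
  by rewrite loc raddfD /= tail0 // addr0 pihomog_dE.
have dfermat (k : 'I_4) (x : 'I_4 -> algC) :
    (fermat^`M(k)).@[x] = 3%:R * x k ^+ 2.
  rewrite (raddf_sum (mderiv k)) raddf_sum (bigD1 k) //= big1 => [|l lk].
    rewrite addr0 mpolyXn mderivX mulmnE mnm1E eqxx mevalZ; congr (_ * _).
    rewrite mevalX (bigD1 k) //= mnmBE mulmnE mnm1E eqxx big1 ?mulr1 // => l lk.
    by rewrite mnmBE mulmnE mnm1E eq_sym (negPf lk).
  by rewrite mpolyXn mderivX mulmnE mnm1E (negPf lk) scale0r meval0.
have unit0 : unit_vec (ord0 : 'I_5) ord0 = 1 by rewrite /unit_vec eqxx.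
exists (unit_vec ord0), ord0; split.
- by rewrite unit0 oner_eq0.
- split=> [d d3|].
    rewrite loc raddfD /= tail0 ?(leq_trans d3) // addr0 (pihomog_ne0 _ fH) //.
    by rewrite eq_sym neq_ltn d3.
  rewrite loc3; apply/eqP => f0; have := dfermat ord0 (fun=> 1).
  rewrite f0 mderiv0 meval0 expr1n mulr1 => /eqP.
  by rewrite eq_sym pnatr_eq0.
- rewrite loc3 => x [k xk] _; exists k.
  by rewrite dfermat mulf_neq0 ?pnatr_eq0 // expf_neq0.
Qed.

(** The quartic-free sextics with [p i != 0] satisfy a polynomial relation
    between their [175] tail coefficients, being a family with [170] parameters;
    the Fermat sextics have arbitrary tails. *)
Lemma quartic_free_closure_proper :
  exists f, triple_point_sextic f /\ ~ quartic_free_closure f.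
Proof.
have rel i : exists P : {mpoly algC[size tail_monomials]}, P != 0 /\
    forall v, P.@[tail_coords (quartic_free_family i v)] = 0.
  have coef_poly (k : tail_index) : exists P : {mpoly algC[#|parameter|]},
      forall v, tail_coords (quartic_free_family i v) k = P.@[v].
    exact: quartic_free_family_polyfamily.
  have [psi psiE] := fin_all_exists coef_poly.
  have [|P P0 PE] := algebraic_dependence psi.
    by rewrite card_parameter size_tail_monomials.
  exists P; split=> // v; have := congr1 (meval v) PE.
  rewrite meval0 comp_mpoly_meval => <-; apply: meval_eq => k.
  by rewrite tnth_mktuple psiE.
have [P PP] := fin_all_exists rel.
pose Q := \prod_i P i.
have Q0 : Q != 0 by apply/prodf_neq0 => i _; have [] := PP i.
have [u Qu] : exists u, Q.@[u] != 0.
  apply: NNPP => no; case/eqP: Q0; apply: mpoly_eq0_nat => v.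
  by apply/eqP; apply: contraT => vN0; case: no; exists (fun k => (v k)%:R).
exists (fermat_sextic u); split; first exact: fermat_sextic_triple_point.
have [t tE] : exists t : tail_index -> 'I_#|sextic_monomials|,
    forall f k, tail_coords f k = sextic_coords f (t k).
  suff /fin_all_exists[t tE] : forall k : tail_index,
      exists l : 'I_#|sextic_monomials|,
        forall f, tail_coords f k = sextic_coords f l.
    by exists t => f k; apply: tE.
  move=> k; have [e [m [e3 em kE]]] := tail_monomialsP (mem_nth 0%MM (ltn_ord
    k)).
  have k6 : mdeg (nth 0%MM tail_monomials k) = 6%N.
    by rewrite kE mdeg_extend_monomial.
  have k7 : (mdeg (nth 0%MM tail_monomials k) < 7)%N by rewrite k6.
  have bS : BMultinom k7 \in sextic_monomials by rewrite unfold_in /= k6.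
  exists (enum_rank_in bS (BMultinom k7)) => f.
  by rewrite /sextic_coords enum_rankK_in.
pose R := Q \mPo [tuple 'X_(t k) | k < size tail_monomials].
have RE f : R.@[sextic_coords f] = Q.@[tail_coords f].
  rewrite comp_mpoly_meval; apply: meval_eq => k.
  by rewrite tnth_mktuple mevalXU tE.
move=> /(_ R); rewrite RE tail_coords_fermat => H; case/eqP: Qu; apply: H.
move=> b /quartic_free_in_family[i [v ->]]; rewrite RE /Q rmorph_prod /=.
by rewrite (bigD1 i) //= (PP i).2 mul0r.
Qed.

Theorem theorem19 :
  exists Z : {mpoly algC[5]} -> Prop,
    proper_closed_in_moduli Z /\
    forall (F : fieldExtType rat) (iota : {rmorphism F -> algC})
           (f : {mpoly F[5]}),
      sextic f ->
      (exists p : 'I_5 -> algC, ordinary_triple_point (map_mpoly iota f) p) ->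
      ~ Z (map_mpoly iota f) ->
      potentially_dense iota f.
Proof.
exists quartic_free_closure; split.
  split; first exact: quartic_free_closure_closed_in_moduli.
  exact: quartic_free_closure_proper.
move=> F iota f [_ fH] [p [i [pi0 h3 hsm]]] fZ.
have fiH : map_mpoly iota f \is 6.-homog := dhomog_map_mpoly iota fH.
set h := local_equation _ p i in h3 hsm.
have [[x0 c30 c40]|no] := classic (exists2 x0,
    (pihomog mdeg 3 h).@[x0] = 0 & (pihomog mdeg 4 h).@[x0] != 0).
  exact: (potentially_dense_of_quartic_term fH pi0 h3 hsm c30 c40).
case: fZ => P; apply.
have [T [Tsym c3E Tsmooth]] := smooth_cubic_polar_form (pihomogP _ 3 h) hsm.
have [|l lE] := quartic_linear_multiple Tsym Tsmooth (pihomogP _ 4 h)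
  (pihomogP _ 3 h) c3E.
  move=> x c3x; apply/eqP; apply: contraT => c4x; case: no.
  by exists x.
exact: (quartic_free_of_multiple fiH pi0 h3 lE).
Qed.
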